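(* Let $E=\mathbb{Q}(\sqrt{-1})$ and $\mathfrak{O}=\mathbb{Z}[\sqrt{-1}]$. If a positive Hermitian $\mathfrak{O}$-lattice represents both $\langle 1,1\rangle$ and $\begin{pmatrix}2&1\\1&2\end{pmatrix}$, then it is $2$-universal.
   Context: A Hermitian $\mathfrak{O}$-lattice is a finitely generated $\mathfrak{O}$-submodule $L$ of a finite-dimensional $E$-vector space equipped with a form $H$ that is linear in the first variable, satisfies $H(x,y)=\overline{H(y,x)}$ (bar is complex conjugation), and has $H(L,L)\subseteq\mathfrak{O}$. Its rank is $\dim_E EL$; binary means rank 2. It is positive (definite) if $H(v):=H(v,v)>0$ for all $0\neq v\in L$. Here every lattice is free ($\mathfrak{O}$ is a PID); the Gram matrix of a lattice with basis $v_1,\dots,v_n$ is $M_L=(H(v_i,v_j))$, and a lattice is identified with its Gram matrix. $\langle a_1,\dots,a_n\rangle$ denotes the lattice with diagonal Gram matrix with entries $a_1,\dots,a_n$. $L$ represents $\ell$ if $M_\ell=XM_LX^*$ for some matrix $X$ over $\mathfrak{O}$, where $X^*$ is the conjugate transpose. A positive Hermitian $\mathfrak{O}$-lattice is $2$-universal if it represents all binary positive Hermitian $\mathfrak{O}$-lattices. *)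

(* Defs.v *)
From HB Require Import structures.
From mathcomp Require Import all_boot all_order all_algebra all_field.
From mathcomp Require Import sesquilinear spectral.

Set Implicit Arguments.
Unset Strict Implicit.
Unset Printing Implicit Defensive.

Import Order.TTheory GRing.Theory Num.Theory.

Local Open Scope ring_scope.
Local Open Scope sesquilinear_scope.

(* The ring O = Z[sqrt(-1)], as a subset of the algebraic complex numbers; the
   library's conjugation on algC restricts to complex conjugation on O. *)
Definition gaussInt : qualifier 1 algC :=
  [qualify a z : algC | ('Re z \is a Num.int) && ('Im z \is a Num.int)].

(* O is a PID, so every lattice is free, and a lattice L of rank n is given by
   its Gram matrix M = (H(v_i, v_j)) on an O-basis v_1, ..., v_n of L.
   The vector \sum_i x_i v_i of L is given by the row x of its coordinates. *)
Definition hermitian_lattice n (M : 'M[algC]_n) : Prop :=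
  M \is hermsymmx /\ M \is a mxOver gaussInt.

(* H is linear in the first variable and semilinear in the second. *)
Definition lattice_form n (M : 'M[algC]_n) (x y : 'rV[algC]_n) : algC :=
  (x *m M *m y ^t*) 0 0.

(* In algC, 0 < z means that z is real and positive. *)
Definition positive_lattice n (M : 'M[algC]_n) : Prop :=
  hermitian_lattice M /\
  forall x : 'rV[algC]_n,
    x \is a mxOver gaussInt -> x != 0 -> 0 < lattice_form M x x.

Definition represents n m (ML : 'M[algC]_n) (Ml : 'M[algC]_m) : Prop :=
  exists2 X : 'M[algC]_(m, n),
    X \is a mxOver gaussInt & Ml = X *m ML *m X ^t*.

Definition two_universal n (ML : 'M[algC]_n) : Prop :=
  forall Ml : 'M[algC]_2, positive_lattice Ml -> represents ML Ml.

Definition lattice_1_1 : 'M[algC]_2 := diag_mx (\row_(_ < 2) 1).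

Definition lattice_21_12 : 'M[algC]_2 :=
  \matrix_(i < 2, j < 2) (if i == j then 2 else 1).

(* Main.v *)
Require Import Defs.
From HB Require Import structures.
From mathcomp Require Import all_boot all_order all_algebra all_field.
From mathcomp Require Import sesquilinear ring zify.

Set Implicit Arguments.
Unset Strict Implicit.
Unset Printing Implicit Defensive.

Import Order.TTheory GRing.Theory Num.Theory.

Local Open Scope ring_scope.

(** Write B for the binary lattice with Gram matrix (2 1; 1 2), N for the norm of
    a Gaussian integer, and D = a c - N(b) for the determinant of the binary
    lattice (a b; b^* c).

    Let L represent both <1,1> and B.  A copy of <1,1> splits L, and the
    projection of a copy of B to the orthogonal complement either contains a
    vector of norm 1 or is again a copy of B, because 3 = det B is not the norm
    of a Gaussian integer.  So L contains <1,1,1> or <1,1> + B (orthogonal sum),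
    and it is enough that these two lattices are 2-universal
    ([universal_111], [universal_11_21_12], combined in [two_universal_hform]).

    A lattice that represents an overlattice of l represents l, and a proper
    overlattice has a smaller determinant.  Hence l may be assumed to have no
    proper integral overlattice, which forces D to be a product of distinct
    primes that are inert in Z[i] ([binary_induction]); in particular D is odd.
    For such a D and any d > 0, a congruence modulo D, solved one prime at a time,
    embeds l in a positive ternary lattice of determinant d ([det_extension]).

    Reduction of positive ternary lattices of determinant d = 1 or 2
    ([ternary_reduction], [treduced_cases]) leaves <1,1,d>, a lattice <1> + l' in
    which l' vanishes modulo 1 + i, and lattices with only even norms.  A parity
    argument excludes the last two when d = 1, and also when d = 2 and l is an odd
    lattice of odd determinant ([ternary_diagonal]).  Thus <1,1,1> is
    2-universal, and every odd l is represented by <1,1,2>, which is contained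
    in <1,1> + B.

    There remains an even l = (2a b; b^* 2c) to be represented by <1,1> + B.
    Twice the norm of s e1 + t e2 + x b1 + y b2 is
    2 N(s) + 2 N(t) + N(2x + y) + 3 N(y).  Taking y = 1 for the first vector of l
    and y = 0 for the second, one has to write the lattice
    (4a - 3, 2b; 2b^*, 4c) as a sum of three Hermitian squares, two of them divisible by
    1 + i and the third congruent to (1, 0) modulo 2.  That lattice is
    positive once l is reduced, unless l is isometric to B; so <1,1,1>
    represents it, and congruences modulo 4 show that every representation
    has the required shape, up to the order of the squares and a unit
    ([hrep_even_of_columns]). *)

(** * The ring of Gaussian integers *)

(** Explicit integer coordinates keep the arguments on norms, order and parity inside
    [int]; the embedding in the algebraic numbers is [zi_algC]. *)
Record zi := Zi { zre : int; zim : int }.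
Definition pair_of_zi z := (zre z, zim z).
Definition zi_of_pair (p : int * int) := Zi p.1 p.2.
Lemma pair_of_ziK : cancel pair_of_zi zi_of_pair. Proof. by case. Qed.
HB.instance Definition _ := Choice.copy zi (can_type pair_of_ziK).

Definition zadd x y := Zi (zre x + zre y) (zim x + zim y).
Definition zopp x := Zi (- zre x) (- zim x).
Definition zmul x y :=
  Zi (zre x * zre y - zim x * zim y) (zre x * zim y + zim x * zre y).

Lemma zaddA : associative zadd. Proof. by move=> x y z; congr Zi => /=; ring. Qed.
Lemma zaddC : commutative zadd. Proof. by move=> x y; congr Zi => /=; ring. Qed.
Lemma zadd0 : left_id (Zi 0 0) zadd. Proof. by case=> x y; congr Zi => /=; ring. Qed.
Lemma zaddN : left_inverse (Zi 0 0) zopp zadd.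
Proof. by case=> x y; congr Zi => /=; ring. Qed.
HB.instance Definition _ := GRing.isZmodule.Build zi zaddA zaddC zadd0 zaddN.

Lemma zmulA : associative zmul. Proof. by move=> x y z; congr Zi => /=; ring. Qed.
Lemma zmulC : commutative zmul. Proof. by move=> x y; congr Zi => /=; ring. Qed.
Lemma zmul1 : left_id (Zi 1 0) zmul. Proof. by case=> x y; congr Zi => /=; ring. Qed.
Lemma zmulD : left_distributive zmul zadd.
Proof. by move=> x y z; congr Zi => /=; ring. Qed.
Lemma zone_neq0 : Zi 1 0 != Zi 0 0. Proof. by []. Qed.
HB.instance Definition _ :=
  GRing.Zmodule_isComNzRing.Build zi zmulA zmulC zmul1 zmulD zone_neq0.

Definition zconj z := Zi (zre z) (- zim z).
Lemma zconj_additive : zmod_morphism zconj.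
Proof. by move=> x y; congr Zi => /=; ring. Qed.
Lemma zconj_multiplicative : monoid_morphism zconj.
Proof. by split=> [|x y]; congr Zi => /=; ring. Qed.
HB.instance Definition _ := GRing.isZmodMorphism.Build zi zi zconj zconj_additive.
HB.instance Definition _ := GRing.isMonoidMorphism.Build zi zi zconj zconj_multiplicative.

Lemma zconjK : involutive zconj.
Proof. by case=> x y; rewrite /zconj /= opprK. Qed.

Lemma intr_zi (n : int) : n%:~R = Zi n 0 :> zi.
Proof.
elim: n => [//|n IH|n IH].
  by rewrite -addn1 PoszD intrD IH; congr Zi => /=; lia.
by rewrite -addn1 PoszD opprD intrD IH; congr Zi => /=; lia.
Qed.

Lemma intr_zi_inj (m n : int) : m%:~R = n%:~R :> zi -> m = n.
Proof. by rewrite !intr_zi => -[]. Qed.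

Definition znorm z : int := zre z ^+ 2 + zim z ^+ 2.

Lemma znormE z : (znorm z)%:~R = z * zconj z.
Proof. by rewrite intr_zi; congr Zi => /=; rewrite /znorm; ring. Qed.

Lemma ztraceE z : (2 * zre z)%:~R = z + zconj z.
Proof. by rewrite intr_zi; congr Zi => /=; ring. Qed.

Lemma znormM : {morph znorm : x y / x * y}.
Proof. by move=> x y; rewrite /znorm /=; ring. Qed.

Lemma znorm_conj z : znorm (zconj z) = znorm z.
Proof. by rewrite /znorm /=; ring. Qed.

Lemma znorm_int n : znorm n%:~R = n ^+ 2.
Proof. by rewrite intr_zi /znorm /=; ring. Qed.

Lemma znorm_ge0 z : 0 <= znorm z.
Proof. by rewrite addr_ge0 ?sqr_ge0. Qed.

Lemma znorm_eq0 z : (znorm z == 0) = (z == 0).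
Proof.
apply/idP/eqP => [|-> //]; case: z => x y; rewrite /znorm /=.
by rewrite paddr_eq0 ?sqr_ge0 // !sqrf_eq0 => /andP[/eqP-> /eqP->].
Qed.

Lemma zre_int n : zre n%:~R = n. Proof. by rewrite intr_zi. Qed.

Lemma zi_dvd_int (n : int) z :
  (n %| zre z)%Z -> (n %| zim z)%Z -> exists w, z = n%:~R * w.
Proof.
case: z => x y /= /dvdzP[u ->] /dvdzP[v ->]; exists (Zi u v).
by rewrite intr_zi; congr Zi => /=; ring.
Qed.

Lemma zi_mulI (k x y : zi) : k != 0 -> k * x = k * y -> x = y.
Proof.
move=> k0 /(congr1 (fun z => z - k * y)); rewrite subrr -mulrBr => /eqP.
rewrite -znorm_eq0 znormM mulf_eq0 !znorm_eq0 (negPf k0) /= subr_eq0.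
by move/eqP.
Qed.

Lemma int_round (x a : int) : 0 < a -> exists q, `|2 * (x + q * a)| <= a.
Proof.
move=> a0; exists (- ((2 * x + a) %/ (2 * a))%Z).
have a2 : 2 * a != 0 by lia.
have := divz_eq (2 * x + a) (2 * a); have := modz_ge0 (2 * x + a) a2.
have := ltz_pmod (2 * x + a) (_ : 0 < 2 * a); lia.
Qed.

Lemma zi_round (z : zi) (a : int) :
  0 < a -> exists t, 2 * znorm (z + t * a%:~R) <= a ^+ 2.
Proof.
move=> a0; have [q hq] := int_round (zre z) a0; have [s hs] := int_round (zim z) a0.
exists (Zi q s); rewrite intr_zi /znorm /=.
set u := zre z + _; set v := zim z + _.
have {}hq : `|2 * u| <= a by rewrite /u mulr0 subr0.
have {}hs : `|2 * v| <= a by rewrite /v mulr0 add0r.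
move: hq hs; clear; clearbody u v; nia.
Qed.

(** * Primes of the Gaussian integers *)

Lemma znorm_gt0 z : z != 0 -> 0 < znorm z.
Proof. by move=> z0; rewrite lt_def znorm_ge0 znorm_eq0 z0. Qed.

Lemma zi_divide (x w : zi) : w != 0 -> exists q, znorm (x - q * w) < znorm w.
Proof.
move=> w0; have N0 := znorm_gt0 w0.
have [t ht] := zi_round (x * zconj w) N0; exists (- t).
have : znorm ((x - - t * w) * zconj w) = znorm (x * zconj w + t * (znorm w)%:~R).
  by rewrite znormE; congr znorm; ring.
rewrite znormM znorm_conj => e; move: ht; rewrite -e.
have := znorm_ge0 (x - - t * w); move: (znorm _) (znorm w) N0 => A W; nia.
Qed.

(** For a prime p this is primality in Z[i]; it is phrased through norms because that
    is how it is used, on forms with p dividing N(b). *)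
Definition inert (p : nat) :=
  forall z, (p%:Z %| znorm z)%Z -> exists w, z = p%:~R * w.

Lemma norm_one_unit z : znorm z = 1 -> z * zconj z = 1.
Proof. by move=> h; rewrite -znormE h. Qed.

(** Euclidean descent: a nonzero element of the ideal generated by a and b that does not
    divide both a and b leaves a remainder of smaller norm. *)
Lemma zi_bezout (a b : zi) : a != 0 ->
  exists w u v q1 q2, [/\ w = u * a + v * b, a = q1 * w & b = q2 * w].
Proof.
move=> a0; pose I (w : zi) := exists u v, w = u * a + v * b.
suff gen n w : (`|znorm w| < n)%N -> w != 0 -> I w ->
    exists w u v q1 q2, [/\ w = u * a + v * b, a = q1 * w & b = q2 * w].
  by apply: (gen _ a (ltnSn _) a0); exists 1, 0; ring.
elim: n w => // n IH w hn w0 Iw.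
have step x : I x -> (exists q, x = q * w) \/
    exists w u v q1 q2, [/\ w = u * a + v * b, a = q1 * w & b = q2 * w].
  move=> Ix; have [q hq] := zi_divide x w0.
  have [e|ne] := eqVneq (x - q * w) 0.
    by left; exists q; apply/eqP; rewrite -subr_eq0 e.
  right; apply: (IH (x - q * w)) => //.
    by have := znorm_ge0 (x - q * w); lia.
  have [u [v ->]] := Ix; have [u' [v' ew]] := Iw.
  by exists (u - q * u'), (v - q * v'); rewrite ew; ring.
have [|[q1 e1]|//] := step a; first by exists 1, 0; ring.
have [|[q2 e2]|//] := step b; first by exists 0, 1; ring.
by have [u [v ew]] := Iw; exists w, u, v, q1, q2.
Qed.

(** The ideal generated by p and z has a generator whose norm divides p^2.  Norm p is
    the first alternative; if the generator is a unit or an associate of p, then p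
    divides z. *)
Lemma split_or_inert (p : nat) (z : zi) : prime p -> (p%:Z %| znorm z)%Z ->
  (exists k, znorm k = p) \/ (exists w, z = p%:~R * w).
Proof.
move=> p_pr pz.
have p0 : (p%:~R : zi) != 0.
  by rewrite -znorm_eq0 znorm_int expf_eq0 /=; have := prime_gt0 p_pr; lia.
have [w [u [v [q1 [q2 [ew e1 e2]]]]]] := zi_bezout z p0.
have eN : znorm q1 * znorm w = p%:Z ^+ 2 by rewrite -znormM -e1 znorm_int.
have : (`|znorm w|%N %| p ^ 2)%N.
  by apply/dvdnP; exists `|znorm q1|%N; rewrite -abszM eN abszX.
have eW : znorm w = `|znorm w|%N by have := znorm_ge0 w; lia.
move/(dvdn_pfactor _ _ p_pr) => [[|[|[|//]]] _ he].
- right; have /dvdzP[m em] := pz.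
  have ww : znorm w = 1 by rewrite eW he.
  exists (w * (zconj u * z + zconj v * m%:~R)).
  have zz : z * zconj z = m%:~R * p%:~R by rewrite -znormE em intrM.
  transitivity (z * (w * zconj w)); first by rewrite norm_one_unit // mulr1.
  rewrite {2}ew.
  transitivity (w * (zconj u * p%:~R * z + zconj v * (z * zconj z))); first by ring.
  by rewrite zz; ring.
- by left; exists w; rewrite eW he expn1.
- right; have q1n : znorm q1 = 1.
    by move: eN; rewrite eW he; have := prime_gt0 p_pr; nia.
  exists (q2 * zconj q1).
  transitivity (z * (q1 * zconj q1)); first by rewrite norm_one_unit // mulr1.
  by rewrite e1 [in LHS]e2; ring.
Qed.

(** For odd p = 2m + 1 the m + 1 squares of 0, ..., m are distinct modulo p, and so are
    the m + 1 values n - y^2; these two subsets of a field with 2m + 1 elements meet. *)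
Lemma znorm_surj_mod (p : nat) (n : int) :
  prime p -> exists z, (p%:Z %| znorm z - n)%Z.
Proof.
move=> p_pr; have [p2|p_odd] := even_prime p_pr.
  exists n%:~R; rewrite znorm_int p2; apply/dvdzP.
  have /orP[|] : (n %% 2 == 0)%Z || (n %% 2 == 1)%Z by lia.
    by move=> /eqP h; exists (n * (n %/ 2)%Z - (n %/ 2)%Z); have := divz_eq n 2; nia.
  by move=> /eqP h; exists (n * (n %/ 2)%Z); have := divz_eq n 2; nia.
pose m := p./2; have pm : p = m.*2.+1 by rewrite -(odd_double_half p) p_odd.
pose sq (i : 'I_m.+1) : 'F_p := (i%:R) ^+ 2.
have sq_inj : injective sq.
  move=> i j /eqP; rewrite -subr_eq0 subr_sqr mulf_eq0 => h.
  apply: val_inj; have := ltn_ord i; have := ltn_ord j => /= hj hi.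
  have [ij|ij|//] := ltngtP i j; move: h.
    rewrite -oppr_eq0 opprB -natrB 1?ltnW // -natrD -!(dvdn_pcharf (pchar_Fp p_pr)).
    by case/orP => /dvdn_leq; lia.
  rewrite -natrB 1?ltnW // -natrD -!(dvdn_pcharf (pchar_Fp p_pr)).
  by case/orP => /dvdn_leq; lia.
pose A := [set sq i | i : 'I_m.+1]; pose B := [set n%:~R - sq i | i : 'I_m.+1].
have cA : #|A| = m.+1 by rewrite card_imset // card_ord.
have cB : #|B| = m.+1.
  by rewrite card_imset ?card_ord // => i j /(@addrI _ _ _ _)/oppr_inj/sq_inj.
have : (0 < #|A :&: B|)%N.
  have le_p : (#|A :|: B| <= m.*2.+1)%N.
    by apply: leq_trans (max_card _) _; rewrite card_Fp // -pm.
  by have := cardsUI A B; rewrite cA cB; lia.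
case/card_gt0P => x; rewrite inE => /andP[/imsetP[i _ ->] /imsetP[j _ /eqP]].
rewrite -subr_eq0 => h; exists (Zi i j); rewrite (dvdz_pcharf (pchar_Fp p_pr)).
by move: h; rewrite /znorm /sq /= rmorphB rmorphD !rmorphXn /= !pmulrn opprB addrA.
Qed.

(** With p = N(k), the product of the real parts of z k^* and z k is equal to
    (Re z)^2 N(k) - (Im k)^2 N(z), hence divisible by p; and an element whose norm is
    divisible by p^2 and whose real part is divisible by p is itself divisible by p. *)
Lemma split_dvd (p : nat) (k z : zi) : prime p -> znorm k = p ->
  (p%:Z %| znorm z)%Z -> (exists w, z = k * w) \/ (exists w, z = zconj k * w).
Proof.
move=> p_pr kp /dvdzP[m em].
have p0 := prime_gt0 p_pr.
have kk : k * zconj k = p%:~R by rewrite -znormE kp.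
have k0 : k != 0 by rewrite -znorm_eq0 kp; lia.
have kc0 : zconj k != 0 by rewrite -znorm_eq0 znorm_conj kp; lia.
have real w : znorm w = m * p%:Z ^+ 2 -> (p%:Z %| zre w)%Z -> exists v, w = p%:~R * v.
  move=> ew /[dup] pr /dvdzP[r er]; apply: zi_dvd_int => //.
  have : (p%:Z ^+ 2 %| zim w ^+ 2)%Z.
    by apply/dvdzP; exists (m - r ^+ 2); move: ew; rewrite /znorm er; lia.
  by rewrite dvdz_pexp2r.
have : (p%:Z %| zre (z * zconj k) * zre (z * k))%Z.
  apply/dvdzP; exists (zre z ^+ 2 - zim k ^+ 2 * m).
  transitivity (zre z ^+ 2 * znorm k - zim k ^+ 2 * znorm z).
    by rewrite /znorm /=; ring.
  by rewrite em kp; ring.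
rewrite dvdzE abszM Euclid_dvdM // => /orP[] /real.
  case=> [|v ev]; first by rewrite znormM znorm_conj em kp; ring.
  by left; exists v; apply: (zi_mulI kc0); rewrite mulrA [_ * k]mulrC kk mulrC.
case=> [|v ev]; first by rewrite znormM em kp; ring.
by right; exists v; apply: (zi_mulI k0); rewrite mulrA kk mulrC.
Qed.

(** * Parity of Gaussian integers *)

Definition iodd (n : int) : bool := odd `|n|%N.
(** The ring morphism from Z[i] to its residue field at 1 + i. *)
Definition zodd (z : zi) : bool := iodd (zre z + zim z).

Lemma ioddD m n : iodd (m + n) = iodd m (+) iodd n.
Proof. by rewrite /iodd; lia. Qed.
Lemma ioddN n : iodd (- n) = iodd n.
Proof. by rewrite /iodd abszN. Qed.
Lemma ioddM m n : iodd (m * n) = iodd m && iodd n.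
Proof. by rewrite /iodd abszM oddM. Qed.

Lemma zoddD x y : zodd (x + y) = zodd x (+) zodd y.
Proof. by rewrite /zodd -ioddD /=; congr iodd; ring. Qed.
Lemma zodd_conj x : zodd (zconj x) = zodd x.
Proof. by rewrite /zodd !ioddD /= ioddN. Qed.
Lemma zoddM x y : zodd (x * y) = zodd x && zodd y.
Proof.
rewrite /zodd /= !ioddD ioddN !ioddM.
by case: (iodd (zre x)) (iodd (zim x)) (iodd (zre y)) (iodd (zim y)) => [] [] [] [].
Qed.
Lemma zodd_int n : zodd n%:~R = iodd n.
Proof. by rewrite intr_zi /zodd addr0. Qed.
Lemma iodd_znorm z : iodd (znorm z) = zodd z.
Proof. by rewrite -zodd_int znormE zoddM zodd_conj andbb. Qed.

(** The prime 1 + i above 2. *)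
Definition zpi := Zi 1 1.

Lemma zeven_dvd_zpi z : zodd z = false -> exists s, z = zpi * s.
Proof.
case: z => x y; rewrite /zodd /iodd /= => h.
exists (Zi ((x + y) %/ 2)%Z ((y - x) %/ 2)%Z).
have := divz_eq (x + y) 2; have := divz_eq (y - x) 2.
have -> : ((x + y) %% 2)%Z = 0 by lia.
have -> : ((y - x) %% 2)%Z = 0 by lia.
by move=> e1 e2; congr Zi => /=; lia.
Qed.

Lemma zodd_norm_mod4 z : zodd z -> exists q, znorm z = 4 * q + 1.
Proof.
case: z => x y; rewrite /zodd /iodd /znorm /= => h.
have : (exists u v, x = 2 * u /\ y = 2 * v + 1) \/ (exists u v, x = 2 * u + 1 /\ y = 2 * v).
  have [ox|ex] := boolP (odd `|x|%N).
    by right; exists (x %/ 2)%Z, (y %/ 2)%Z; split; lia.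
  by left; exists (x %/ 2)%Z, (y %/ 2)%Z; split; lia.
case=> [] [u [v [-> ->]]].
  by exists (u ^+ 2 + v ^+ 2 + v); ring.
by exists (u ^+ 2 + v ^+ 2 + u); ring.
Qed.

Lemma zodd_unit z : zodd z -> exists u k, znorm u = 1 /\ u * z = 1 + 2%:~R * k.
Proof.
case: z => x y; rewrite /zodd /iodd /= => h.
have [ox|ex] := boolP (odd `|x|%N).
  exists (Zi 1 0), (Zi (x %/ 2)%Z (y %/ 2)%Z); split=> //.
  by rewrite intr_zi; congr Zi => /=; lia.
exists (Zi 0 (-1)), (Zi (y %/ 2)%Z (- (x %/ 2)%Z)); split=> //.
by rewrite intr_zi; congr Zi => /=; lia.
Qed.

Lemma zpi_norm s : znorm (zpi * s) = 2 * znorm s.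
Proof. by rewrite znormM. Qed.

(** * Binary forms and their overlattices *)

(** The determinant of the Hermitian form (a b; b^* c). *)
Definition disc (a : int) (b : zi) (c : int) : int := a * c - znorm b.

(** The properties of a form (a b; b^* c) on vectors x, y to be proved by descent are
    inherited by sublattices.  The three clauses cover exchanging
    x and y, returning from x + t y to x, and passing from x to k x. *)
Definition saturated (P : int -> zi -> int -> Prop) :=
  [/\ forall a b c, P c (zconj b) a -> P a b c,
      forall a b c t,
        P (a + 2 * zre (t * zconj b) + znorm t * c) (b + t * c%:~R) c -> P a b c
    & forall a b c k, P a b c -> P (znorm k * a) (k * b) c].

Definition squarefree_inert (D : int) := forall p : nat, prime p -> (p%:Z %| D)%Z ->
  inert p /\ ~ (p%:Z ^+ 2 %| D)%Z.

Lemma disc_swap a b c : disc c (zconj b) a = disc a b c.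
Proof. by rewrite /disc znorm_conj mulrC. Qed.

Lemma disc_shear a b c t :
  disc (a + 2 * zre (t * zconj b) + znorm t * c) (b + t * c%:~R) c = disc a b c.
Proof. by rewrite /disc intr_zi /znorm /=; ring. Qed.

Lemma disc_gt0 a b c : 0 < a -> 0 < disc a b c -> 0 < c.
Proof. by rewrite /disc => a0 D0; have := znorm_ge0 b; nia. Qed.

Section OverlatticeStep.

Variables (P : int -> zi -> int -> Prop) (a : int) (b : zi) (c : int).
Hypotheses (satP : saturated P) (a0 : 0 < a) (D0 : 0 < disc a b c).
Hypothesis IH : forall a' b' c',
  0 < a' -> 0 < disc a' b' c' < disc a b c -> P a' b' c'.

(** The lattice spanned by x and y sits in the one spanned by x / k and y, whose
    determinant is smaller by the factor N(k). *)
Lemma sublattice_scale k a' b' c' : 1 < znorm k ->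
  disc (znorm k * a') (k * b') c' = disc a b c -> 0 < c' -> P (znorm k * a') (k * b') c'.
Proof.
move=> k1 e c0; have [_ _ scale] := satP; apply/scale/IH.
  have : 0 < znorm k * a' * c'.
    by have := znorm_ge0 (k * b'); move: D0; rewrite -e /disc; lia.
  by move: c0 k1; nia.
have {}e : disc a b c = znorm k * disc a' b' c'.
  by rewrite -e /disc znormM; ring.
by move: D0 k1; rewrite e; nia.
Qed.

(** As c is invertible modulo N(k), some x + t y has a product with y divisible by k.
    Then N(k) divides a' c = D + N(b + t c), hence a', and (x + t y) / k can be adjoined. *)
Lemma overlattice_coprime k : 1 < znorm k ->
  (znorm k %| disc a b c)%Z -> coprimez (znorm k) c -> P a b c.
Proof.
move=> k1 /dvdzP[m em] kc; have [[u v] /= uv] := coprimezP _ _ kc.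
have c0 := disc_gt0 a0 D0.
have [_ shear _] := satP; pose t := - v%:~R * b; apply: (shear _ _ _ t).
pose b' := zconj k * u%:~R * b.
have eb : b + t * c%:~R = k * b'.
  transitivity (b * (u * znorm k)%:~R); last by rewrite /b' intrM znormE; ring.
  have -> : u * znorm k = 1 - v * c by lia.
  by rewrite rmorphB /= intrM /t; ring.
set a' := a + _ + _.
have eD : a' * c - znorm (k * b') = disc a b c by rewrite -eb -(disc_shear a b c t).
have : (znorm k %| a' * c)%Z.
  apply/dvdzP; exists (m + znorm b'); move: eD em; rewrite znormM; lia.
rewrite Gauss_dvdzl // => /dvdzP[a'' ea]; rewrite eb ea mulrC.
by apply: sublattice_scale => //; rewrite -eD ea /disc; ring.
Qed.

End OverlatticeStep.

Lemma not_coprime_prime (p : nat) (n : int) :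
  prime p -> ~~ coprimez p n -> exists m, n = p%:Z * m.
Proof.
move=> p_pr; rewrite coprimezE /= prime_coprime // negbK => pn.
have /dvdzP[m ->] : (p %| n)%Z by [].
by exists m; rewrite mulrC.
Qed.

Section Overlattices.

Variables (P : int -> zi -> int -> Prop) (a : int) (b : zi) (c : int).
Hypotheses (satP : saturated P) (a0 : 0 < a) (D0 : 0 < disc a b c).
Hypothesis IH : forall a' b' c',
  0 < a' -> 0 < disc a' b' c' < disc a b c -> P a' b' c'.

Lemma overlattice_coprime_either k : 1 < znorm k -> (znorm k %| disc a b c)%Z ->
  coprimez (znorm k) c || coprimez (znorm k) a -> P a b c.
Proof.
move=> k1 kD /orP[|] co; first exact: (overlattice_coprime satP a0 D0 IH k1).
have [swap _ _] := satP; apply: swap.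
have c0 := disc_gt0 a0 D0.
apply: (overlattice_coprime satP c0 _ _ k1); rewrite ?disc_swap //.
Qed.

(** When p divides both a and c it divides N(b), so b is divisible by k or by k^*,
    and the first basis vector can be divided by the same number. *)
Lemma overlattice_split (p : nat) k : prime p -> znorm k = p ->
  (p%:Z %| disc a b c)%Z -> P a b c.
Proof.
move=> p_pr kp pD; have p1 := prime_gt1 p_pr.
have c0 := disc_gt0 a0 D0.
case: (boolP (coprimez p c || coprimez p a)) => [co|].
  by apply: (@overlattice_coprime_either k); rewrite kp.
rewrite negb_or => /andP[/(not_coprime_prime p_pr)[c' ec] /(not_coprime_prime p_pr)[a' ea]].
have pb : (p%:Z %| znorm b)%Z.
  rewrite (_ : znorm b = a * c - disc a b c); last by rewrite /disc; ring.
  by rewrite rpredB // ea -mulrA dvdz_mulr.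
have [k' [kp' [b' eb]]] : exists k', znorm k' = p /\ exists b', b = k' * b'.
  by have [h|h] := split_dvd p_pr kp pb;
     [exists k | exists (zconj k); rewrite znorm_conj].
have -> : a = znorm k' * a' by rewrite kp' ea.
rewrite eb; apply: (sublattice_scale satP a0 D0 IH) => //; first by rewrite kp'.
by rewrite kp' -ea -eb.
Qed.

(** When p divides both a and c it divides b, and the form is p times a form l'.  The norm
    being surjective modulo p, l' represents a multiple of p by a vector v outside p l';
    then v / p can be adjoined. *)
Lemma overlattice_inert (p : nat) : prime p -> inert p ->
  (p%:Z ^+ 2 %| disc a b c)%Z -> P a b c.
Proof.
move=> p_pr ip pD; have p1 := prime_gt1 p_pr.
have c0 := disc_gt0 a0 D0.
have np : znorm p%:~R = p%:Z ^+ 2 by rewrite znorm_int.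
have np1 : 1 < znorm p%:~R by rewrite np; nia.
case: (boolP (coprimez p c || coprimez p a)) => [co|].
  apply: (@overlattice_coprime_either p%:~R) => //; rewrite np //.
  by rewrite !coprimez_pexpl.
rewrite negb_or => /andP[/(not_coprime_prime p_pr)[c' ec] /(not_coprime_prime p_pr)[a' ea]].
have pb : (p%:Z %| znorm b)%Z.
  rewrite (_ : znorm b = a * c - disc a b c); last by rewrite /disc; ring.
  apply: rpredB; first by rewrite ea -mulrA dvdz_mulr.
  by apply: dvdz_trans pD; rewrite dvdz_exp.
have [b' eb] := ip _ pb.
have [swap shear _] := satP.
(* if p divides c', the second basis vector itself can be divided by p *)
case: (boolP (coprimez p c')) => [/coprimezP[[v u] /= uv]|]; last first.
  move=> /(not_coprime_prime p_pr)[c'' ec'']; apply: swap.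
  have -> : c = znorm p%:~R * c'' by rewrite np ec ec''; ring.
  rewrite eb rmorphM /= rmorph_int.
  apply: (sublattice_scale satP (a := c) (b := zconj b) (c := a)) => //;
    rewrite ?disc_swap //.
  rewrite -disc_swap rmorphM /= rmorph_int zconjK -eb; congr (disc _ _ _).
  by rewrite np ec ec''; ring.
(* in the form l' = (a' b'; b'^* c') of determinant D', the norm of x + t y
   times c' is N(b' + t c') + D', and t makes b' + t c' congruent to z modulo p *)
have [z /dvdzP[s hz]] := znorm_surj_mod (- disc a' b' c') p_pr.
pose t := u%:~R * (z - b').
pose w := v%:~R * (b' - z).
have ebt : b' + t * c'%:~R = z + p%:~R * w.
  transitivity (b' + (u * c')%:~R * (z - b')); first by rewrite /t intrM; ring.
  have -> : u * c' = 1 - v * p by lia.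
  by rewrite rmorphB /= intrM /w; ring.
apply: (shear _ _ _ t).
set a1 := a' + 2 * zre (t * zconj b') + znorm t * c'.
have ea1 : a + 2 * zre (t * zconj b) + znorm t * c = p%:Z * a1.
  by rewrite /a1 ea eb ec !intr_zi /=; ring.
have eb1 : b + t * c%:~R = p%:~R * (b' + t * c'%:~R).
  by rewrite eb ec intrM; ring.
have pa1 : (p%:Z %| a1)%Z.
  have cp : coprimez p c' by apply/coprimezP; exists (v, u).
  rewrite -(Gauss_dvdzl _ cp).
  have -> : a1 * c' = disc a' b' c' + znorm (b' + t * c'%:~R).
    by rewrite -(disc_shear a' b' c' t) /disc -/a1; ring.
  rewrite ebt; apply/dvdzP.
  exists (s + 2 * zre (z * zconj w) + p%:Z * znorm w).
  have -> : znorm (z + p%:~R * w) = znorm z + p%:Z * (2 * zre (z * zconj w)) + p%:Z^+2 * znorm w.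
    by rewrite intr_zi /znorm /=; ring.
  move: hz; lia.
have [a2 ea2] : exists a2, a1 = p%:Z * a2 by case/dvdzP: pa1 => a2 ->; exists a2; ring.
have -> : a + 2 * zre (t * zconj b) + znorm t * c = znorm p%:~R * a2.
  by rewrite ea1 ea2 np; ring.
rewrite eb1; apply: (sublattice_scale satP a0 D0 IH) => //.
rewrite -(disc_shear a b c t) eb1; congr (disc _ _ _).
by rewrite ea1 ea2 np; ring.
Qed.

(** Whether p is a norm is a bounded search, and by [split_or_inert] it is inert if it
    is not. *)
Lemma overlattice_or_inert (p : nat) : prime p -> (p%:Z %| disc a b c)%Z ->
  (inert p /\ ~ (p%:Z ^+ 2 %| disc a b c)%Z) \/ P a b c.
Proof.
move=> p_pr pD.
case: (boolP [exists i : 'I_p.+1, exists j : 'I_p.+1, i ^ 2 + j ^ 2 == p]%N).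
  move=> /existsP[i /existsP[j /eqP ij]]; right.
  by apply: (@overlattice_split p (Zi i j)); rewrite // /znorm /=; lia.
move=> no_norm; have ip : inert p.
  move=> z /(split_or_inert p_pr)[[k kp]|//]; case/negP: no_norm.
  have p0 := prime_gt0 p_pr.
  have le_p (x y : int) : x ^+ 2 + y ^+ 2 = p -> (`|x| < p.+1)%N by nia.
  apply/existsP; exists (Ordinal (le_p _ _ kp)); apply/existsP.
  have kp' : zim k ^+ 2 + zre k ^+ 2 = p by rewrite addrC.
  exists (Ordinal (le_p _ _ kp')) => /=; apply/eqP.
  by move: kp; rewrite /znorm; lia.
have [p2D|] := boolP (p%:Z ^+ 2 %| disc a b c)%Z; last by move/negP; left.
by right; apply: overlattice_inert p2D.
Qed.

End Overlattices.

(** Used on the prime factors p of D, where either p is inert and divides D once, or the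
    desired conclusion holds. *)
Lemma forall_or (T : eqType) (s : seq T) (A : T -> Prop) (B : Prop) :
  (forall x, x \in s -> A x \/ B) -> (forall x, x \in s -> A x) \/ B.
Proof.
elim: s => [_|x s IH h]; first by left.
have [y ys||] := IH; [by apply: h; rewrite inE ys orbT| |by right].
have [Ax As|] := h x (mem_head _ _); last by right.
by left => y; rewrite inE => /predU1P[->|/As].
Qed.

(** A form that does not satisfy the condition on its determinant has a proper integral
    overlattice, of smaller determinant. *)
Lemma binary_induction P : saturated P ->
  (forall a b c, 0 < a -> 0 < disc a b c -> squarefree_inert (disc a b c) -> P a b c) ->
  forall a b c, 0 < a -> 0 < disc a b c -> P a b c.
Proof.
move=> satP base a b c; have [n] := ubnP `|disc a b c|%N.
elim: n a b c => // n IHn a b c hn a0 D0.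
have IH a' b' c' : 0 < a' -> 0 < disc a' b' c' < disc a b c -> P a' b' c'.
  by move=> a'0 /andP[? ?]; apply: IHn => //; lia.
have [|sq|//] := @forall_or _ (primes `|disc a b c|)
  (fun p => inert p /\ ~ (p%:Z ^+ 2 %| disc a b c)%Z) (P a b c).
  move=> p; rewrite mem_primes => /and3P[p_pr _ pD].
  exact: (overlattice_or_inert satP a0 D0 IH).
apply: base => // p p_pr pD; apply: sq; rewrite mem_primes p_pr /=.
by apply/andP; split; [lia | exact: pD].
Qed.

(** The prime 2 = N(1 + i) is not inert. *)
Lemma squarefree_inert_odd D : squarefree_inert D -> iodd D.
Proof.
move=> sq; apply/negPn/negP => D_even.
have [|inert2 _] := sq 2%N isT; first by move: D_even; rewrite /iodd; lia.
have [|w] := inert2 zpi; first by [].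
move=> /(congr1 zre); rewrite intr_zi /=; lia.
Qed.

(** * Extending a binary form to a ternary form of given determinant *)

(** Expanding along the last row and column, the ternary form with Gram matrix
    (a b e; b^* c f; e^* f^* r) has determinant r D minus this value. *)
Definition adjoint_form a b c e f : int :=
  a * znorm f + c * znorm e - 2 * zre (b * f * zconj e).

Lemma adjoint_form_shift a b c e f (m : int) s t : exists k,
  adjoint_form a b c (e + m%:~R * s) (f + m%:~R * t) = adjoint_form a b c e f + m * k.
Proof.
exists (a * (2 * zre (f * zconj t) + m * znorm t) + c * (2 * zre (e * zconj s) + m * znorm s)
  - 2 * zre (b * f * zconj s) - 2 * zre (b * t * zconj e) - 2 * m * zre (b * t * zconj s)).
by rewrite /adjoint_form !intr_zi /znorm /=; ring.
Qed.

Lemma adjoint_form_crt a b c (d : int) (m n : int) : coprimez m n ->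
  (exists e f, (m %| adjoint_form a b c e f + d)%Z) ->
  (exists e f, (n %| adjoint_form a b c e f + d)%Z) ->
  exists e f, (m * n %| adjoint_form a b c e f + d)%Z.
Proof.
move=> mn [e1 [f1 h1]] [e2 [f2 h2]]; have [[u v] /= uv] := coprimezP _ _ mn.
(* u m + v n = 1, so e and f agree with e1, f1 modulo m and with e2, f2 modulo n *)
pose e := e1 + m%:~R * (u%:~R * (e2 - e1)); pose f := f1 + m%:~R * (u%:~R * (f2 - f1)).
have ee : e = e2 + n%:~R * (v%:~R * (e1 - e2)).
  transitivity (e2 * (u * m + v * n)%:~R + (e1 - e2) * (1 - u * m)%:~R).
    by rewrite uv rmorphB /= intrM /e; ring.
  by rewrite uv (_ : 1 - u * m = v * n) ?intrM; [ring | lia].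
have ef : f = f2 + n%:~R * (v%:~R * (f1 - f2)).
  transitivity (f2 * (u * m + v * n)%:~R + (f1 - f2) * (1 - u * m)%:~R).
    by rewrite uv rmorphB /= intrM /f; ring.
  by rewrite uv (_ : 1 - u * m = v * n) ?intrM; [ring | lia].
exists e, f; rewrite Gauss_dvdz //; apply/andP; split.
  have [k ->] := adjoint_form_shift a b c e1 f1 m (u%:~R * (e2 - e1)) (u%:~R * (f2 - f1)).
  by rewrite addrAC rpredD // dvdz_mulr.
rewrite ee ef.
have [k ->] := adjoint_form_shift a b c e2 f2 n (v%:~R * (e1 - e2)) (v%:~R * (f1 - f2)).
by rewrite addrAC rpredD // dvdz_mulr.
Qed.

(** If p does not divide c or a, one of the two diagonal terms already takes every value
    modulo p; if p divides both, it divides b too and p^2 divides D. *)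
Lemma adjoint_form_prime a b c (d : int) (p : nat) : prime p -> inert p ->
  (p%:Z %| disc a b c)%Z -> ~ (p%:Z ^+ 2 %| disc a b c)%Z ->
  exists e f, (p%:Z %| adjoint_form a b c e f + d)%Z.
Proof.
move=> p_pr ip pD p2D.
have solve c' : coprimez p c' -> exists e, (p%:Z %| c' * znorm e + d)%Z.
  move=> /coprimezP[[v u] /= uv].
  have [z /dvdzP[s hs]] := znorm_surj_mod (- u * d) p_pr.
  exists z; apply/dvdzP; exists (c' * s + v * d).
  have -> : znorm z = s * p - u * d by lia.
  have : d * (v * p + u * c') = d by rewrite uv mulr1.
  lia.
case: (boolP (coprimez p c)) => [/solve[e he]|/(not_coprime_prime p_pr)[c' ec]].
  exists e, 0; move: he; congr (_ %| _ + d)%Z.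
  by rewrite /adjoint_form /znorm /=; ring.
case: (boolP (coprimez p a)) => [/solve[f hf]|/(not_coprime_prime p_pr)[a' ea]].
  exists 0, f; move: hf; congr (_ %| _ + d)%Z.
  by rewrite /adjoint_form /znorm /=; ring.
case: p2D; have pb : (p%:Z %| znorm b)%Z.
  rewrite (_ : znorm b = a * c - disc a b c); last by rewrite /disc; ring.
  by apply: rpredB => //; rewrite ea -mulrA dvdz_mulr.
have [b' eb] := ip _ pb.
apply/dvdzP; exists (a' * c' - znorm b').
by rewrite /disc ea ec eb znormM znorm_int; ring.
Qed.

(** The entry r exists as soon as D divides d plus the adjoint form at (e, f); the
    congruence is solved modulo each prime factor of D and lifted, D being squarefree. *)
Lemma det_extension a b c (d : int) : 0 < disc a b c -> squarefree_inert (disc a b c) ->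
  exists e f r, r * disc a b c = d + adjoint_form a b c e f.
Proof.
move=> D0 sq.
suff [e [f /dvdzP[r hr]]] : exists e f, (disc a b c %| adjoint_form a b c e f + d)%Z.
  by exists e, f, r; rewrite addrC.
suff gen (n m : nat) : (m < n)%N -> (0 < m)%N -> (m %| `|disc a b c|)%N ->
    exists e f, (m%:Z %| adjoint_form a b c e f + d)%Z.
  have := gen _ `|disc a b c|%N (ltnSn _) _ (dvdnn _).
  by rewrite gtz0_abs //; apply; lia.
elim: n m => // n IH m mn m0 mD.
have [m1|m1] := leqP m 1.
  have -> : m = 1%N by lia.
  by exists 0, 0; rewrite dvd1z.
have p_pr := pdiv_prime m1; set p := pdiv m in p_pr.
have /dvdnP[m' em] : (p %| m)%N := pdiv_dvd m.
have p1 := prime_gt1 p_pr.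
have m'0 : (0 < m')%N by lia.
have pD : (p %| `|disc a b c|)%N by apply: dvdn_trans mD; rewrite em dvdn_mull.
have [ip p2] := sq p p_pr pD.
have co : coprimez p m'.
  rewrite coprimezE /= prime_coprime //; apply/negP => /dvdnP[m2 em2]; case: p2.
  rewrite dvdzE abszX; apply: dvdn_trans mD; apply/dvdnP; exists m2.
  by rewrite em em2 /= -mulnA mulnn.
rewrite em mulnC PoszM; apply: adjoint_form_crt => //.
  exact: adjoint_form_prime.
by apply: IH => //; [nia | apply: dvdn_trans mD; rewrite em dvdn_mulr].
Qed.

(** * Hermitian modules and the binary lattices they represent *)

(** Semilinearity in the second variable follows from the second clause. *)
Definition hermitian_form (V : lmodType zi) (h : V -> V -> zi) : Prop :=
  (forall k x y z, h (k *: x + y) z = k * h x z + h y z) /\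
  (forall x y, h y x = zconj (h x y)).

Section HermitianModule.

Variables (V : lmodType zi) (h : V -> V -> zi).
Hypothesis herm : hermitian_form h.

Lemma hformC x y : h y x = zconj (h x y).
Proof. by have [_] := herm. Qed.

Lemma hformDl x y z : h (x + y) z = h x z + h y z.
Proof. by have [lin _] := herm; rewrite -[x]scale1r lin mul1r scale1r. Qed.

Lemma hform0l z : h 0 z = 0.
Proof. by have := hformDl 0 0 z; rewrite addr0 => /eqP; rewrite addrC -subr_eq subrr => /eqP. Qed.

Lemma hformZl k x z : h (k *: x) z = k * h x z.
Proof. by have [lin _] := herm; rewrite -[k *: x]addr0 lin hform0l addr0. Qed.

Lemma hformDr x y z : h z (x + y) = h z x + h z y.
Proof. by rewrite hformC hformDl rmorphD /= -!hformC. Qed.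

Lemma hformZr k x z : h z (k *: x) = zconj k * h z x.
Proof. by rewrite hformC hformZl rmorphM /= -hformC. Qed.

Definition hformE := (hformDl, hformZl, hformDr, hformZr).

(** The representation of the binary lattice (a b; b^* c) by a Hermitian module. *)
Definition hrep a b c := exists x y, [/\ h x x = a%:~R, h x y = b & h y y = c%:~R].

Lemma hrep_saturated : saturated hrep.
Proof.
split=> [a b c [x [y [xx xy yy]]]|a b c t [x [y [xx xy yy]]]|a b c k [x [y [xx xy yy]]]].
- by exists y, x; rewrite (hformC x y) xy zconjK.
- exists (x + (- t) *: y), y; rewrite !hformE (hformC x y) xx xy yy; split=> //; last by ring.
  rewrite intrD intrD ztraceE intrM znormE !(rmorphD, rmorphM, rmorphN) /= !zconjK rmorph_int.
  by ring.
- exists (k *: x), y; rewrite !hformE xx xy yy; split=> //.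
  by rewrite intrM znormE; ring.
Qed.

End HermitianModule.

(** * Reduction of ternary forms *)

(** The Gram matrix (a b e; b^* c f; e^* f^* r) of a basis v1, v2, v3. *)
Record tern := Tern { ta : int; tb : zi; te : zi; tc : int; tf : zi; tr : int }.

Definition tlead M := disc (ta M) (tb M) (tc M).
Definition tdet M : int := ta M * tc M * tr M + 2 * zre (tb M * tf M * zconj (te M))
  - ta M * znorm (tf M) - tc M * znorm (te M) - tr M * znorm (tb M).
(** Positive definiteness, by Sylvester's criterion on the leading minors. *)
Definition tpos M := [/\ 0 < ta M, 0 < tlead M & 0 < tdet M].

(** Regular modules, so that triples of Gaussian integers form a module over them. *)
Definition vec3 := (zi^o * zi^o * zi^o)%type.
Definition tform M (x y : vec3) : zi :=
  let: (x1, x2, x3) := x in let: (y1, y2, y3) := y in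
  (ta M)%:~R * x1 * zconj y1 + (tc M)%:~R * x2 * zconj y2 + (tr M)%:~R * x3 * zconj y3
  + tb M * x1 * zconj y2 + zconj (tb M) * x2 * zconj y1
  + te M * x1 * zconj y3 + zconj (te M) * x3 * zconj y1
  + tf M * x2 * zconj y3 + zconj (tf M) * x3 * zconj y2.

Definition trep M := hrep (tform M).

Lemma tform_hermitian M : hermitian_form (tform M).
Proof.
split=> [k|] [[x1 x2] x3] [[y1 y2] y3] => [[[z1 z2] z3]|]; rewrite /tform /=.
  by rewrite /GRing.scale /=; ring.
by rewrite !(rmorphD, rmorphM) /= !zconjK !rmorph_int; ring.
Qed.

(** The effect on the Gram matrix of the elementary changes of basis: [swapij] exchanges
    vi and vj, and [shearij t] replaces vi by vi + t vj. *)
Definition swap12 M := Tern (tc M) (zconj (tb M)) (tf M) (ta M) (te M) (tr M).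
Definition swap23 M := Tern (ta M) (te M) (tb M) (tr M) (zconj (tf M)) (tc M).
Definition shear21 t M := Tern (ta M) (tb M + zconj t * (ta M)%:~R) (te M)
  (tc M + 2 * zre (t * tb M) + znorm t * ta M) (tf M + t * te M) (tr M).
Definition shear31 t M := Tern (ta M) (tb M) (te M + zconj t * (ta M)%:~R) (tc M)
  (tf M + zconj t * zconj (tb M)) (tr M + 2 * zre (t * te M) + znorm t * ta M).
Definition shear32 t M := Tern (ta M) (tb M) (te M + zconj t * tb M) (tc M)
  (tf M + zconj t * (tc M)%:~R) (tr M + 2 * zre (t * tf M) + znorm t * tc M).

Lemma intr_shear (c a : int) t z :
  (c + 2 * zre z + znorm t * a)%:~R
  = c%:~R + (z + zconj z) + t * zconj t * a%:~R :> zi.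
Proof. by rewrite intrD intrM znormE -ztraceE -intrD. Qed.

(** The map [g] is the change of coordinates inverse to a change of basis. *)
Lemma trep_transport M M' (g : vec3 -> vec3) a b c :
  (forall x y, tform M' (g x) (g y) = tform M x y) -> trep M a b c -> trep M' a b c.
Proof. by move=> gE [x [y [ex exy ey]]]; exists (g x), (g y); rewrite !gE. Qed.

Lemma trep_swap12 M a b c : trep M a b c -> trep (swap12 M) a b c.
Proof.
apply: (trep_transport (g := fun x => let: (x1, x2, x3) := x in (x2, x1, x3))).
by move=> [[x1 x2] x3] [[y1 y2] y3]; rewrite /tform /= zconjK; ring.
Qed.

Lemma trep_swap23 M a b c : trep M a b c -> trep (swap23 M) a b c.
Proof.
apply: (trep_transport (g := fun x => let: (x1, x2, x3) := x in (x1, x3, x2))).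
by move=> [[x1 x2] x3] [[y1 y2] y3]; rewrite /tform /= zconjK; ring.
Qed.

Lemma trep_shear21 t M a b c : trep M a b c -> trep (shear21 t M) a b c.
Proof.
apply: (trep_transport (g := fun x => let: (x1, x2, x3) := x in (x1 - t * x2, x2, x3))).
move=> [[x1 x2] x3] [[y1 y2] y3]; rewrite /tform.
cbn [shear21 ta tb te tc tf tr].
by rewrite intr_shear !(rmorphD, rmorphM) /= !zconjK !rmorph_int; ring.
Qed.

Lemma trep_shear31 t M a b c : trep M a b c -> trep (shear31 t M) a b c.
Proof.
apply: (trep_transport (g := fun x => let: (x1, x2, x3) := x in (x1 - t * x3, x2, x3))).
move=> [[x1 x2] x3] [[y1 y2] y3]; rewrite /tform.
cbn [shear31 ta tb te tc tf tr].
by rewrite intr_shear !(rmorphD, rmorphM) /= !zconjK !rmorph_int; ring.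
Qed.

Lemma trep_shear32 t M a b c : trep M a b c -> trep (shear32 t M) a b c.
Proof.
apply: (trep_transport (g := fun x => let: (x1, x2, x3) := x in (x1, x2 - t * x3, x3))).
move=> [[x1 x2] x3] [[y1 y2] y3]; rewrite /tform.
cbn [shear32 ta tb te tc tf tr].
by rewrite intr_shear !(rmorphD, rmorphM) /= !zconjK !rmorph_int; ring.
Qed.

Lemma tdet_swap12 M : tdet (swap12 M) = tdet M.
Proof. by case: M => a b e c f r; rewrite /tdet /znorm /=; ring. Qed.
Lemma tdet_swap23 M : tdet (swap23 M) = tdet M.
Proof. by case: M => a b e c f r; rewrite /tdet /znorm /=; ring. Qed.
Lemma tdet_shear21 t M : tdet (shear21 t M) = tdet M.
Proof. by case: M => a b e c f r; rewrite /tdet /= !intr_zi /znorm /=; ring. Qed.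
Lemma tdet_shear31 t M : tdet (shear31 t M) = tdet M.
Proof. by case: M => a b e c f r; rewrite /tdet /= !intr_zi /znorm /=; ring. Qed.
Lemma tdet_shear32 t M : tdet (shear32 t M) = tdet M.
Proof. by case: M => a b e c f r; rewrite /tdet /= !intr_zi /znorm /=; ring. Qed.

Lemma tlead_swap12 M : tlead (swap12 M) = tlead M.
Proof. by rewrite /tlead disc_swap. Qed.
Lemma tlead_shear21 t M : tlead (shear21 t M) = tlead M.
Proof. by case: M => a b e c f r; rewrite /tlead /disc /= !intr_zi /znorm /=; ring. Qed.

(** The off-diagonal entry of the binary form obtained by projecting v2 and v3 on the
    orthogonal complement of v1 and multiplying by [ta M]; the diagonal entries of that
    form are [tlead M] and [tlead (swap23 M)]. *)
Definition tproj M : zi := (ta M)%:~R * tf M - zconj (tb M) * te M.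

(** The projected binary form has determinant [ta M * tdet M]. *)
Lemma tlead_mul M :
  tlead M * tlead (swap23 M) = ta M * tdet M + znorm (tproj M).
Proof.
by case: M => a b e c f r; rewrite /tlead /disc /tdet /tproj /= !intr_zi /znorm /=; ring.
Qed.

Lemma tproj_shear31 t M : tproj (shear31 t M) = tproj M.
Proof. by rewrite /tproj /=; ring. Qed.

Lemma tproj_shear32 t M : tproj (shear32 t M) = tproj M + zconj t * (tlead M)%:~R.
Proof. by rewrite /tproj /tlead /disc /= (rmorphB (intmul 1)) /= intrM znormE; ring. Qed.

Lemma tpos_swap12 M : tpos M -> tpos (swap12 M).
Proof.
move=> [a0 l0 d0]; split; rewrite ?tlead_swap12 ?tdet_swap12 //.
exact: disc_gt0 a0 l0.
Qed.

Lemma tpos_swap23 M : tpos M -> tpos (swap23 M).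
Proof.
move=> [a0 l0 d0]; split; rewrite ?tdet_swap23 //.
have := tlead_mul M; have := znorm_ge0 (tproj M); have : 0 < ta M * tdet M by nia.
by move: l0; nia.
Qed.

Lemma tpos_shear21 t M : tpos M -> tpos (shear21 t M).
Proof. by move=> [a0 l0 d0]; split; rewrite ?tlead_shear21 ?tdet_shear21. Qed.
Lemma tpos_shear31 t M : tpos M -> tpos (shear31 t M).
Proof. by move=> [a0 l0 d0]; split; rewrite ?tdet_shear31. Qed.
Lemma tpos_shear32 t M : tpos M -> tpos (shear32 t M).
Proof. by move=> [a0 l0 d0]; split; rewrite ?tdet_shear32. Qed.

(** The Hermitian analogue of Korkine-Zolotarev reduction: v1 is shortest in the basis,
    the projected form is reduced, and the coefficients along v1 are minimal. *)
Definition treduced M :=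
  [/\ ta M <= tc M, ta M <= tr M, tlead M <= tlead (swap23 M) &
  [/\ 2 * znorm (tb M) <= ta M ^+ 2, 2 * znorm (te M) <= ta M ^+ 2 &
      2 * znorm (tproj M) <= tlead M ^+ 2]].

Lemma zi_round_conj (z : zi) (a : int) :
  0 < a -> exists t, 2 * znorm (z + zconj t * a%:~R) <= a ^+ 2.
Proof. by move=> /(zi_round z)[t ht]; exists (zconj t); rewrite zconjK. Qed.

(** Lexicographic descent on the pair ([ta], [tlead]).  The shears leave the pair alone
    and give the bounds on [tb], [te] and [tproj]; an exchange of two basis vectors
    decreases the pair unless the remaining inequalities hold. *)
Lemma ternary_reduction M a b c : tpos M -> trep M a b c ->
  exists M', [/\ tpos M', tdet M' = tdet M, trep M' a b c & treduced M'].
Proof.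
suff gen (m n : nat) M0 : (`|ta M0| < m)%N -> (`|tlead M0| < n)%N -> tpos M0 ->
    trep M0 a b c -> exists M', [/\ tpos M', tdet M' = tdet M0, trep M' a b c & treduced M'].
  exact: (gen _ _ M (ltnSn _) (ltnSn _)).
elim: m n M0 => // m IHm n; elim: n => // n IHn M0 hm hn pos rep.
have [t1 h1] := zi_round_conj (tb M0) (let: And3 a0 _ _ := pos in a0).
pose M1 := shear21 t1 M0.
have pos1 : tpos M1 := tpos_shear21 t1 pos.
have [t2 h2] := zi_round_conj (tproj M1) (let: And3 _ l0 _ := pos1 in l0).
pose M2 := shear32 t2 M1.
have pos2 : tpos M2 := tpos_shear32 t2 pos1.
have [t3 h3] := zi_round_conj (te M2) (let: And3 a0 _ _ := pos2 in a0).
pose M3 := shear31 t3 M2.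
have pos3 : tpos M3 := tpos_shear31 t3 pos2.
have rep3 : trep M3 a b c by apply/trep_shear31/trep_shear32/trep_shear21.
have det3 : tdet M3 = tdet M0 by rewrite tdet_shear31 tdet_shear32 tdet_shear21.
have a3 : ta M3 = ta M0 by [].
have l3 : tlead M3 = tlead M0 by rewrite -(tlead_shear21 t1 M0).
have b3 : 2 * znorm (tb M3) <= ta M3 ^+ 2 by [].
have e3 : 2 * znorm (te M3) <= ta M3 ^+ 2 by [].
have g3 : 2 * znorm (tproj M3) <= tlead M3 ^+ 2.
  by rewrite tproj_shear31 tproj_shear32.
clearbody M3; clear M1 M2 pos1 pos2 h1 h2 h3.
have descend M' : tpos M' -> tdet M' = tdet M3 -> trep M' a b c ->
    ta M' < ta M3 \/ ta M' <= ta M3 /\ tlead M' < tlead M3 ->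
    exists M', [/\ tpos M', tdet M' = tdet M0, trep M' a b c & treduced M'].
  rewrite det3 => pos' <- rep' lt'; have [a'0 l'0 _] := pos'.
  case: lt' => [lt'|[le' lt']].
    by apply: (IHm `|tlead M'|.+1 M') => //; lia.
  by apply: (IHn M') => //; lia.
have [lt_ca|le_ac] := ltrP (tc M3) (ta M3).
  apply: (descend (swap12 M3)); rewrite ?tdet_swap12 //; first exact: tpos_swap12.
    exact: trep_swap12.
  by left.
have [lt_ra|le_ar] := ltrP (tr M3) (ta M3).
  apply: (descend (swap12 (swap23 M3))); rewrite ?tdet_swap12 ?tdet_swap23 //.
  - exact/tpos_swap12/tpos_swap23.
  - exact/trep_swap12/trep_swap23.
  - by left.
have [lt_l|le_l] := ltrP (tlead (swap23 M3)) (tlead M3).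
  apply: (descend (swap23 M3)); rewrite ?tdet_swap23 //; first exact: tpos_swap23.
    exact: trep_swap23.
  by right.
by exists M3; rewrite det3; split.
Qed.

(** * Ternary forms of determinant 1 and 2 *)

(** Writing a for [ta M], l for [tlead M] and d for the determinant, the reduction
    inequalities give l^2 <= 2 a d and a^2 <= 2 l, hence a^3 <= 8 d and a <= 2. *)
Lemma treduced_cases M : tpos M -> treduced M -> tdet M = 1 \/ tdet M = 2 ->
  [\/ M = Tern 1 0 0 1 0 (tdet M),
      exists2 f, znorm f = 2 & M = Tern 1 0 0 2 f 2
    | [/\ ta M = 2, tc M = 2 & tr M = 2]].
Proof.
move=> [a0 l0 d0] [ac ar le_l [b_le e_le g_le]] d12.
have := tlead_mul M; set d := tdet M in d12 d0 *; set l := tlead M in l0 le_l g_le *.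
set l' := tlead (swap23 M) in le_l *; set g := tproj M in g_le *.
move=> ll'; have lc : l = ta M * tc M - znorm (tb M) by [].
have l'r : l' = ta M * tr M - znorm (te M) by [].
have l2 : l * l <= 2 * (ta M * d) by nia.
have a2 : ta M * ta M <= 2 * l by nia.
have le2 : ta M <= 2.
  rewrite leNgt; apply/negP => a3.
  have : 3 * ta M <= 2 * l by nia.
  have : 3 * ta M * (3 * ta M) <= 8 * (ta M * d) by nia.
  by nia.
have := znorm_ge0 (tb M); have := znorm_ge0 (te M); have := znorm_ge0 g => g0 e0 b0.
have {a0 le2} /orP[/eqP a1|/eqP a1] : (ta M == 1) || (ta M == 2) by lia.
  rewrite a1 in lc l'r ll' l2 a2 b_le e_le ac ar.
  have /eqP : znorm (tb M) = 0 by lia.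
  have /eqP : znorm (te M) = 0 by lia.
  rewrite !znorm_eq0 => /eqP e1 /eqP b1.
  have gf : g = tf M by rewrite /g /tproj a1 e1 mulr0 subr0 mul1r.
  rewrite e1 b1 /znorm /= in lc l'r; rewrite gf in g_le ll' g0.
  have /orP[/eqP c1|/eqP c2] : (tc M == 1) || (tc M == 2) by nia.
    have /eqP : znorm (tf M) = 0 by nia.
    rewrite znorm_eq0 => /eqP f1; apply: Or31.
    have : tr M = d by rewrite f1 /znorm /= in ll'; nia.
    by case: (M) a1 e1 b1 c1 f1 => /= a b e c f r -> -> -> -> -> ->.
  have f2 : znorm (tf M) = 2 /\ tr M = 2 by nia.
  apply: Or32; exists (tf M); first by case: f2.
  by case: (M) a1 e1 b1 c2 f2 => /= a b e c f r -> -> -> -> [_ ->].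
apply: Or33; rewrite a1 in lc l'r ll' l2 a2 b_le e_le ac ar.
have l2' : l = 2 by nia.
rewrite l2' in lc ll' g_le le_l.
have c2 : tc M = 2 by lia.
by split=> //; lia.
Qed.

(** The two other cases of [treduced_cases] are excluded by parity.  If the form is
    <1> plus a form that vanishes modulo 1 + i, every represented binary lattice has even
    determinant.  If the diagonal is even, so are all represented norms, and the
    determinant itself cannot be 1. *)
Lemma ternary_diagonal M a b c : tpos M -> trep M a b c ->
  tdet M = 1 \/ [/\ tdet M = 2, iodd (disc a b c) & iodd a || iodd c] ->
  trep (Tern 1 0 0 1 0 (tdet M)) a b c.
Proof.
move=> pos rep dM; have [M' [pos' det' rep' red']] := ternary_reduction pos rep.
rewrite -det' in dM *; clear M pos rep det'.
have [|<- //|[f f2 eM]|[a2 c2 r2]] := treduced_cases pos' red'.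
  by case: dM => [|[]]; [left|right].
- case: dM => [|[_ D_odd _]].
    by rewrite eM /tdet /= f2 /znorm /=; lia.
  move: rep' => [[[x1 x2] x3] [[[y1 y2] y3] []]].
  have fE : zodd f = false by rewrite -iodd_znorm f2.
  rewrite eM /tform /=.
  move=> /(congr1 zodd) + /(congr1 zodd) + /(congr1 zodd).
  rewrite !(zoddD, zoddM, zodd_conj, zodd_int, fE) /=.
  move: D_odd; rewrite /disc ioddD ioddN ioddM iodd_znorm.
  by move=> + e1 e2 e3; rewrite -e1 -e2 -e3; case: (zodd x1) (zodd y1) => [] [].
move: rep' => [x [y [exx _ eyy]]].
case: dM => [|[_ _]].
  by rewrite /tdet a2 c2 r2; lia.
have even_form z n : tform M' z z = n%:~R -> iodd n = false.
  rewrite -zodd_int => <-; case: z => [[z1 z2] z3].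
  rewrite /tform a2 c2 r2 !(zoddD, zoddM, zodd_conj, zodd_int) /=.
  by move: (zodd _) (zodd _) (zodd _) (zodd _) (zodd _) (zodd _) => [] [] [] [] [] [].
by rewrite (even_form _ _ exx) (even_form _ _ eyy).
Qed.

(** * Lattices containing three orthonormal vectors *)

(** Only the determinant has to be made positive: the other leading minors are those
    of the binary form. *)
Lemma pos_ternary_extension a b c (d : int) : 0 < a -> 0 < disc a b c -> 0 < d ->
  squarefree_inert (disc a b c) ->
  exists M, [/\ tpos M, tdet M = d & trep M a b c].
Proof.
move=> a0 D0 d0 sq; have [e [f [r er]]] := det_extension d D0 sq.
have detM : tdet (Tern a b e c f r) = d.
  move: er; rewrite /tdet /disc /adjoint_form /=; lia.
exists (Tern a b e c f r); split=> //; first by split; rewrite ?detM.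
by exists (1, 0, 0), (0, 1, 0); rewrite /tform /= !rmorph0 !rmorph1; split; ring.
Qed.

(** The 2-universality of <1,1,1>, in coordinates. *)
Lemma sum_three_norms a b c : 0 < a -> 0 < disc a b c -> trep (Tern 1 0 0 1 0 1) a b c.
Proof.
move: a b c; apply: binary_induction; first exact/hrep_saturated/tform_hermitian.
move=> a b c a0 D0 sq; have [M [posM detM repM]] := pos_ternary_extension a0 D0 ltr01 sq.
by have := ternary_diagonal posM repM (or_introl detM); rewrite detM.
Qed.

Section Universality.

Variables (V : lmodType zi) (h : V -> V -> zi).
Hypothesis herm : hermitian_form h.

Lemma hrep_diagonal (d : int) e1 e2 e3 a b c :
  h e1 e1 = 1 -> h e2 e2 = 1 -> h e3 e3 = d%:~R ->
  h e1 e2 = 0 -> h e1 e3 = 0 -> h e2 e3 = 0 ->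
  trep (Tern 1 0 0 1 0 d) a b c -> hrep h a b c.
Proof.
move=> h11 h22 h33 h12 h13 h23 [[[x1 x2] x3] [[[y1 y2] y3] [exx exy eyy]]].
have E (u1 u2 u3 v1 v2 v3 : zi) : h (u1 *: e1 + u2 *: e2 + u3 *: e3)
    (v1 *: e1 + v2 *: e2 + v3 *: e3) = tform (Tern 1 0 0 1 0 d) (u1, u2, u3) (v1, v2, v3).
  rewrite !(hformE herm) (hformC herm e1 e2) (hformC herm e1 e3) (hformC herm e2 e3).
  rewrite h11 h22 h33 h12 h13 h23 /tform /= rmorph0; ring.
by exists (x1 *: e1 + x2 *: e2 + x3 *: e3), (y1 *: e1 + y2 *: e2 + y3 *: e3); rewrite !E.
Qed.

Lemma universal_111 e1 e2 e3 :
  h e1 e1 = 1 -> h e2 e2 = 1 -> h e3 e3 = 1 ->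
  h e1 e2 = 0 -> h e1 e3 = 0 -> h e2 e3 = 0 ->
  forall a b c, 0 < a -> 0 < disc a b c -> hrep h a b c.
Proof.
move=> h11 h22 h33 h12 h13 h23 a b c a0 D0.
by apply: (@hrep_diagonal 1 e1 e2 e3) => //; apply: sum_three_norms.
Qed.

End Universality.

(** * Lattices containing the orthogonal sum of <1,1> and (2 1; 1 2) *)

(** Gauss reduction; the parities are carried along because they are invariant under
    a change of basis. *)
Lemma binary_reduction_even P : saturated P ->
  (forall a b c, 0 < a -> 0 < disc a b c -> iodd (disc a b c) -> ~~ iodd a -> ~~ iodd c ->
     a <= c -> 2 * znorm b <= a ^+ 2 -> P a b c) ->
  forall a b c, 0 < a -> 0 < disc a b c -> iodd (disc a b c) -> ~~ iodd a -> ~~ iodd c ->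
  P a b c.
Proof.
move=> [swap shear _] base a b c; have [n] := ubnP `|c|%N.
elim: n a b c => // n IH a b c hn a0 D0 D_odd a_even c_even.
have c0 := disc_gt0 a0 D0; have [t ht] := zi_round b c0; apply: (shear _ _ _ t).
move: D0 D_odd; rewrite -(disc_shear a b c t); set a' := a + _ + _; set b' := b + _ in ht *.
move=> D0 D_odd; apply: swap.
have a'_even : ~~ iodd a'.
  by rewrite /a' !(ioddD, ioddM) (negPf c_even) (negPf a_even) andbF.
rewrite -disc_swap in D0 D_odd; have a'0 := disc_gt0 c0 D0.
have [lt_ac|le_ca] := ltrP a' c; first by apply: IH => //; lia.
by apply: base; rewrite ?znorm_conj.
Qed.

Section Universality21.

Variables (V : lmodType zi) (h : V -> V -> zi).
Hypothesis herm : hermitian_form h.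
Variables e1 e2 b1 b2 : V.
Hypotheses (h11 : h e1 e1 = 1) (h22 : h e2 e2 = 1) (h12 : h e1 e2 = 0).
Hypotheses (k11 : h b1 b1 = 2%:~R) (k22 : h b2 b2 = 2%:~R) (k12 : h b1 b2 = 1).
Hypotheses (o11 : h e1 b1 = 0) (o12 : h e1 b2 = 0) (o21 : h e2 b1 = 0) (o22 : h e2 b2 = 0).

Lemma form_21_12 (s1 s2 x1 x2 t1 t2 y1 y2 : zi) :
  h (s1 *: e1 + s2 *: e2 + x1 *: b1 + x2 *: b2) (t1 *: e1 + t2 *: e2 + y1 *: b1 + y2 *: b2)
  = s1 * zconj t1 + s2 * zconj t2 + 2%:~R * x1 * zconj y1 + 2%:~R * x2 * zconj y2
    + x1 * zconj y2 + x2 * zconj y1.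
Proof.
rewrite !(hformE herm) (hformC herm e1 e2) (hformC herm e1 b1) (hformC herm e1 b2).
rewrite (hformC herm e2 b1) (hformC herm e2 b2) (hformC herm b1 b2).
by rewrite h11 h22 h12 k11 k22 k12 o11 o12 o21 o22 rmorph0 rmorph1; ring.
Qed.

(** The case where the coordinates of the first vector are even, even and odd.  The norm 4a - 3
    forces x1 / (1 + i) and x2 / (1 + i) to have the same parity.  The
    coordinate y3 is even by the scalar product 2b, so y1 and y2 have the same parity; if they
    were odd, the norm 4c would make y3 / (1 + i) odd, and the scalar product
    divided by 1 + i would be odd on one side only.  So y1 and y2 are even as well, and
    then the scalar product shows that 2 divides y3. *)
Lemma hrep_even_of_columns x1 x2 x3 y1 y2 y3 (a : int) b (c : int) :
  zodd x1 = false -> zodd x2 = false -> zodd x3 ->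
  x1 * zconj x1 + x2 * zconj x2 + x3 * zconj x3 = (4 * a - 3)%:~R ->
  x1 * zconj y1 + x2 * zconj y2 + x3 * zconj y3 = 2%:~R * b ->
  y1 * zconj y1 + y2 * zconj y2 + y3 * zconj y3 = (4 * c)%:~R ->
  hrep h (2 * a) b (2 * c).
Proof.
move=> /zeven_dvd_zpi[s1 ->] /zeven_dvd_zpi[s2 ->] odd3 exx exy eyy.
have nx : znorm (zpi * s1) + znorm (zpi * s2) + znorm x3 = 4 * a - 3.
  by apply: intr_zi_inj; rewrite -exx -!znormE -!intrD.
have ny : znorm y1 + znorm y2 + znorm y3 = 4 * c.
  by apply: intr_zi_inj; rewrite -eyy -!znormE -!intrD.
rewrite !zpi_norm in nx.
have [q3 n3] := zodd_norm_mod4 odd3.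
have ss : zodd s1 = zodd s2.
  by rewrite -!iodd_znorm; move: nx; rewrite n3 /iodd; lia.
have y3_even : zodd y3 = false.
  have := congr1 zodd exy.
  by rewrite !(zoddD, zoddM, zodd_conj, zodd_int) odd3 /= => ->.
have yy : zodd y1 = zodd y2.
  by rewrite -!iodd_znorm; move: ny y3_even; rewrite -iodd_znorm /iodd; lia.
have [m ey3] := zeven_dvd_zpi y3_even.
(* 2 and (1 + i)^* are associates of (1 + i)^2 and 1 + i *)
have zi2 : 2%:~R = Zi 0 (-1) * zpi * zpi by [].
have conj_pi : zconj zpi = Zi 0 (-1) * zpi by [].
have pi0 : zpi != 0 by [].
have y1_even : zodd y1 = false.
  apply/negP => y1_odd; have y2_odd : zodd y2 by rewrite -yy.
  have [q1 n1] := zodd_norm_mod4 y1_odd; have [q2 n2] := zodd_norm_mod4 y2_odd.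
  have m_odd : zodd m.
    by rewrite -iodd_znorm; move: ny; rewrite n1 n2 ey3 zpi_norm /iodd; lia.
  have : zpi * (s1 * zconj y1 + s2 * zconj y2 + Zi 0 (-1) * x3 * zconj m)
       = zpi * (Zi 0 (-1) * zpi * b).
    transitivity (2%:~R * b); last by rewrite zi2; ring.
    by rewrite -exy ey3 rmorphM /= conj_pi; ring.
  move=> /(zi_mulI pi0)/(congr1 zodd); rewrite !(zoddD, zoddM, zodd_conj).
  by rewrite y1_odd y2_odd ss odd3 m_odd /=; case: (zodd s2).
have y2_even : zodd y2 = false by rewrite -yy.
have [t1 et1] := zeven_dvd_zpi y1_even; have [t2 et2] := zeven_dvd_zpi y2_even.
have [u [k [u1 eu]]] := zodd_unit odd3.
have uu := norm_one_unit u1.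
have pipi : zpi * zconj zpi = 2%:~R by [].
have pipiE s t : zpi * s * zconj (zpi * t) = 2%:~R * (s * zconj t).
  by rewrite -pipi; ring.
pose w := b - s1 * zconj t1 - s2 * zconj t2.
have ew : x3 * zconj y3 = 2%:~R * w.
  transitivity (2%:~R * b - (zpi * s1 * zconj y1 + zpi * s2 * zconj y2)).
    by rewrite -exy; ring.
  by rewrite et1 et2 /w !pipiE; ring.
pose n := u * zconj (u * w - k * zconj y3).
have en : u * y3 = 2%:~R * n.
  have : zconj y3 = 2%:~R * (u * w - k * zconj y3).
    transitivity (u * x3 * zconj y3 - 2%:~R * k * zconj y3); first by rewrite eu; ring.
    by rewrite -mulrA ew; ring.
  move=> /(congr1 zconj); rewrite zconjK => ->.
  by rewrite /n rmorphM /= rmorph_int; ring.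
have ux (v v' : zi) : v * zconj v' = (u * v) * zconj (u * v').
  by rewrite rmorphM /= mulrACA uu mul1r.
(* 2x + y is 1 + 2k with y = 1 for the first vector, 2n with y = 0 for the second *)
exists (s1 *: e1 + s2 *: e2 + k *: b1 + 1 *: b2), (t1 *: e1 + t2 *: e2 + n *: b1 + 0 *: b2).
rewrite !form_21_12 rmorph0 rmorph1.
have two0 : (2%:~R : zi) != 0 by [].
split; apply: (zi_mulI two0).
- transitivity ((4 * a - 3)%:~R + 3%:~R : zi); last first.
    by rewrite -intrD -intrM; congr intmul; ring.
  by rewrite -exx (ux x3) eu !pipiE; ring.
- by rewrite -exy (ux x3) eu en et1 et2 !pipiE; ring.
- transitivity ((4 * c)%:~R : zi); last by rewrite -intrM; congr intmul; ring.
  by rewrite -eyy (ux y3) en et1 et2 !pipiE; ring.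
Qed.

(** The form (4a - 3, 2b; 2b^*, 4c) has positive determinant unless a = c = 1; in that case b
    is a unit and the form is isometric to (2 1; 1 2).  Three odd coordinates x1, x2, x3
    would have norms summing to 3 modulo 4, so exactly one of them is odd. *)
Lemma hrep_even_reduced a b c :
  0 < a -> zodd b -> a <= c -> znorm b <= 2 * a ^+ 2 -> hrep h (2 * a) b (2 * c).
Proof.
move=> a0 b_odd le_ac nb.
have b_mod4 := zodd_norm_mod4 b_odd.
have [[a1 c1 n1]|D'0] : [/\ a = 1, c = 1 & znorm b = 1] \/
    0 < disc (4 * a - 3) (2%:~R * b) (4 * c).
  rewrite /disc znormM znorm_int; case: b_mod4 => q nq.
  have [a1|a2] := eqVneq a 1.
    have n1 : znorm b = 1 by have := znorm_ge0 b; rewrite a1 in nb; lia.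
    have [c1|c2] := eqVneq c 1; first by left.
    by right; rewrite a1 n1; lia.
  by right; have : 2 * a ^+ 2 < c * (4 * a - 3); nia.
  exists (b *: b1), b2; rewrite !(hformE herm) k11 k12 k22 a1 c1; split=> //; last by ring.
  transitivity ((znorm b)%:~R * 2%:~R : zi); last by rewrite n1.
  by rewrite znormE; ring.
have a'0 : 0 < 4 * a - 3 by lia.
have [[[x1 x2] x3] [[[y1 y2] y3] [exx exy eyy]]] := sum_three_norms a'0 D'0.
have {}exx : x1 * zconj x1 + x2 * zconj x2 + x3 * zconj x3 = (4 * a - 3)%:~R.
  by rewrite -exx /tform /= rmorph0; ring.
have {}exy : x1 * zconj y1 + x2 * zconj y2 + x3 * zconj y3 = 2%:~R * b.
  by rewrite -exy /tform /= rmorph0; ring.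
have {}eyy : y1 * zconj y1 + y2 * zconj y2 + y3 * zconj y3 = (4 * c)%:~R.
  by rewrite -eyy /tform /= rmorph0; ring.
have nx : znorm x1 + znorm x2 + znorm x3 = 4 * a - 3.
  by apply: intr_zi_inj; rewrite -exx -!znormE -!intrD.
have par : zodd x1 (+) zodd x2 (+) zodd x3.
  by rewrite -!iodd_znorm -!ioddD nx /iodd; lia.
have [o1|o1] := boolP (zodd x1); have [o2|o2] := boolP (zodd x2);
  have [o3|o3] := boolP (zodd x3);
  rewrite ?o1 ?o2 ?o3 ?(negPf o1) ?(negPf o2) ?(negPf o3) //= in par.
- have [[q1 n1] [q2 n2] [q3 n3]] :=
    And3 (zodd_norm_mod4 o1) (zodd_norm_mod4 o2) (zodd_norm_mod4 o3).
  by move: nx; rewrite n1 n2 n3; lia.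
- apply: (@hrep_even_of_columns x3 x2 x1 y3 y2 y1) => //; try exact: negPf.
  + by rewrite -exx; ring.
  + by rewrite -exy; ring.
  + by rewrite -eyy; ring.
- apply: (@hrep_even_of_columns x1 x3 x2 y1 y3 y2) => //; try exact: negPf.
  + by rewrite -exx; ring.
  + by rewrite -exy; ring.
  + by rewrite -eyy; ring.
- by apply: (@hrep_even_of_columns x1 x2 x3 y1 y2 y3) => //; exact: negPf.
Qed.

(** A form with an odd diagonal entry is represented by the lattice <1,1,2> spanned by e1,
    e2 and b1; the others are reduced first. *)
Lemma universal_11_21_12 a b c : 0 < a -> 0 < disc a b c -> hrep h a b c.
Proof.
have sat := hrep_saturated herm.
move: a b c; apply: (binary_induction sat) => a b c a0 D0 sq.
have D_odd := squarefree_inert_odd sq.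
have [odd_ac|] := boolP (iodd a || iodd c).
  have [M [posM detM repM]] := pos_ternary_extension a0 D0 (isT : 0 < 2 :> int) sq.
  apply: (hrep_diagonal herm h11 h22 k11 h12 o11 o21).
  by have := ternary_diagonal posM repM (or_intror (And3 detM D_odd odd_ac)); rewrite detM.
rewrite negb_or => /andP[a_even c_even]; move: a b c a0 D0 D_odd a_even c_even {sq}.
apply: (binary_reduction_even sat) => a b c a0 D0 D_odd a_even c_even le_ac nb.
have half n : ~~ iodd n -> exists m, n = 2 * m.
  by rewrite /iodd => n_even; exists (n %/ 2)%Z; lia.
have [a' ea] := half a a_even; have [c' ec] := half c c_even.
have b_odd : zodd b.
  move: D_odd; rewrite /disc ioddD ioddN ioddM (negPf a_even) /= iodd_znorm //.
rewrite ea ec in a0 D0 le_ac nb *.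
by apply: hrep_even_reduced => //; lia.
Qed.

End Universality21.

(** * A lattice representing <1,1> and (2 1; 1 2) *)

Lemma hform_real (V : lmodType zi) (h : V -> V -> zi) : hermitian_form h ->
  forall x, h x x = (zre (h x x))%:~R.
Proof.
move=> herm x; have := hformC herm x x; case: (h x x) => u v [ev].
by rewrite intr_zi /=; congr Zi; lia.
Qed.

(** The vector [pr w] is the projection of w to the orthogonal complement of e1 and e2.
    The projections of u and v have norm at most 2.  A projection of norm 1 completes e1
    and e2 to three orthonormal vectors.  Otherwise each is 0 or the vector itself.
    Both cannot vanish, as (2 1; 1 2) would then be represented by <1,1> and its
    determinant 3 would be a norm; one alone cannot vanish, since h u v = 1. *)
Lemma two_universal_hform (V : lmodType zi) (h : V -> V -> zi) : hermitian_form h ->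
  (forall x, x != 0 -> 0 < zre (h x x)) ->
  (exists e1 e2, [/\ h e1 e1 = 1, h e1 e2 = 0 & h e2 e2 = 1]) ->
  (exists u v, [/\ h u u = 2%:~R, h u v = 1 & h v v = 2%:~R]) ->
  forall a b c, 0 < a -> 0 < disc a b c -> hrep h a b c.
Proof.
move=> herm pos [e1 [e2 [h11 h12 h22]]] [u [v [huu huv hvv]]].
have h21 : h e2 e1 = 0 by rewrite (hformC herm e1 e2) h12 rmorph0.
pose pr (w : V) := w + (- h w e1) *: e1 + (- h w e2) *: e2.
have pr1 w : h (pr w) e1 = 0 by rewrite !(hformE herm) h11 h21; ring.
have pr2 w : h (pr w) e2 = 0 by rewrite !(hformE herm) h12 h22; ring.
have pr1' w : h e1 (pr w) = 0 by rewrite (hformC herm) pr1 rmorph0.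
have pr2' w : h e2 (pr w) = 0 by rewrite (hformC herm) pr2 rmorph0.
have prE w z : h (pr w) (pr z) = h w z - h w e1 * zconj (h z e1) - h w e2 * zconj (h z e2).
  have -> : h (pr w) (pr z) = h (pr w) z.
    by move: (pr w) (pr1 w) (pr2 w) => x x1 x2; rewrite /pr !(hformE herm) x1 x2; ring.
  by rewrite /pr !(hformE herm) (hformC herm z e1) (hformC herm z e2); ring.
have pr_norm w : zre (h (pr w) (pr w)) = zre (h w w) - znorm (h w e1) - znorm (h w e2).
  by rewrite prE -!znormE !intr_zi.
have pr_ge0 w : pr w = 0 \/ 0 < zre (h (pr w) (pr w)).
  by have [|/pos] := eqVneq (pr w) 0; [left|right].
have split_unit w : zre (h (pr w) (pr w)) = 1 ->
    forall a b c, 0 < a -> 0 < disc a b c -> hrep h a b c.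
  move=> w1; apply: (universal_111 herm h11 h22 _ h12 (pr1' w) (pr2' w)).
  by rewrite (hform_real herm) w1.
have nu := pr_norm u; have nv := pr_norm v.
rewrite huu hvv !intr_zi /= in nu nv.
have [u1|u1] := eqVneq (zre (h (pr u) (pr u))) 1; first exact: split_unit u1.
have [v1|v1] := eqVneq (zre (h (pr v) (pr v))) 1; first exact: split_unit v1.
have h00 : h 0 0 = 0 := hform0l herm 0.
have nu1 := znorm_ge0 (h u e1); have nu2 := znorm_ge0 (h u e2).
have nv1 := znorm_ge0 (h v e1); have nv2 := znorm_ge0 (h v e2).
have vanish (w : V) (n : int) : n = 2 - znorm (h w e1) - znorm (h w e2) -> 0 < n -> n != 1 ->
    h w e1 = 0 /\ h w e2 = 0.
  have := znorm_ge0 (h w e1); have := znorm_ge0 (h w e2).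
  by split; apply/eqP; rewrite -znorm_eq0; lia.
have puv := prE u v.
have [pu0|pu] := pr_ge0 u; have [pv0|pv] := pr_ge0 v.
- have one : h u e1 * zconj (h v e1) + h u e2 * zconj (h v e2) = 1.
    move: puv; rewrite pu0 hform0l // huv => puv.
    by apply/eqP; rewrite eq_sym -subr_eq0 opprD addrA -puv.
  rewrite pu0 pv0 h00 in nu nv.
  have : znorm (h u e1 * h v e2 - h u e2 * h v e1) = 3.
    (* Lagrange's identity: 2 * 2 = N(1) + N(x w - y z) *)
    have lagrange (x y z w : zi) : (znorm x + znorm y) * (znorm z + znorm w) =
        znorm (x * zconj z + y * zconj w) + znorm (x * w - y * z).
      by rewrite /znorm /=; ring.
    have := lagrange (h u e1) (h u e2) (h v e1) (h v e2); rewrite one.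
    have -> : znorm (h u e1) + znorm (h u e2) = 2 by move: nu => /=; lia.
    have -> : znorm (h v e1) + znorm (h v e2) = 2 by move: nv => /=; lia.
    by rewrite (_ : znorm 1 = 1) //; lia.
  move: (_ - _) => z nz; have [/zodd_norm_mod4[q]|] := boolP (zodd z); first by lia.
  by move=> /negPf/zeven_dvd_zpi[s ez]; rewrite ez zpi_norm in nz; lia.
- have [vz1 vz2] := vanish _ _ nv pv v1.
  by move: puv; rewrite pu0 hform0l // vz1 vz2 huv !rmorph0 !mulr0 !subr0.
- have [uz1 uz2] := vanish _ _ nu pu u1.
  by move: puv; rewrite uz1 uz2 huv !mul0r !subr0 pv0 (hformC herm) hform0l // rmorph0.
have [uz1 uz2] := vanish _ _ nu pu u1; have [vz1 vz2] := vanish _ _ nv pv v1.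
apply: (universal_11_21_12 (b1 := pr u) (b2 := pr v) herm h11 h22 h12) => //.
- by rewrite (hform_real herm) nu uz1 uz2.
- by rewrite (hform_real herm) nv vz1 vz2.
- by rewrite puv uz1 uz2 !mul0r !subr0.
Qed.

(** * Lattices over the algebraic numbers *)

Local Open Scope sesquilinear_scope.

(** The embedding of Z[i] in the algebraic numbers, with image [gaussInt]. *)
Definition zi_algC (z : zi) : algC := (zre z)%:~R + 'i * (zim z)%:~R.

Lemma zi_algC_additive : zmod_morphism zi_algC.
Proof. by move=> x y; rewrite /zi_algC /= !rmorphD !rmorphN /=; ring. Qed.

Lemma zi_algC_multiplicative : monoid_morphism zi_algC.
Proof.
split=> [|x y]; first by rewrite /zi_algC /= mulr0 addr0.
have i2 : 'i * 'i = -1 :> algC by rewrite -expr2 sqrCi.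
by rewrite /zi_algC /= !(rmorphD, rmorphN, rmorphM) /=; ring: i2.
Qed.
HB.instance Definition _ := GRing.isZmodMorphism.Build zi algC zi_algC zi_algC_additive.
HB.instance Definition _ :=
  GRing.isMonoidMorphism.Build zi algC zi_algC zi_algC_multiplicative.

Lemma zi_algC_conj z : zi_algC (zconj z) = (zi_algC z)^*.
Proof.
rewrite /zi_algC rmorphD rmorphM /= conjCi !rmorph_int rmorphN /=; ring.
Qed.

Lemma Re_zi_algC z : 'Re (zi_algC z) = (zre z)%:~R.
Proof. by rewrite Re_rect ?realz. Qed.
Lemma Im_zi_algC z : 'Im (zi_algC z) = (zim z)%:~R.
Proof. by rewrite Im_rect ?realz. Qed.

Lemma zi_algC_inj : injective zi_algC.
Proof.
move=> [a b] [c d] e; congr Zi; apply: (@intr_inj algC).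
  by rewrite -[LHS](Re_zi_algC (Zi a b)) e Re_zi_algC.
by rewrite -[LHS](Im_zi_algC (Zi a b)) e Im_zi_algC.
Qed.

Lemma gaussIntP z : reflect (exists w, z = zi_algC w) (z \is a gaussInt).
Proof.
apply: (iffP andP) => [[/intrP[a ea] /intrP[b eb]]|[w ->]].
  by exists (Zi a b); rewrite [LHS]Crect ea eb.
by rewrite Re_zi_algC Im_zi_algC !intr_int.
Qed.

Lemma mxOver_gaussIntP m n (A : 'M[algC]_(m, n)) :
  reflect (exists B, A = map_mx zi_algC B) (A \is a mxOver gaussInt).
Proof.
apply: (iffP mxOverP) => [Aint|[B -> i j]]; last by rewrite mxE; apply/gaussIntP; exists (B i j).
have /fin_all_exists[f fE] : forall ij : 'I_m * 'I_n, exists w, A ij.1 ij.2 = zi_algC w.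
  by move=> ij; apply/gaussIntP.
by exists (\matrix_(i, j) f (i, j)); apply/matrixP => i j; rewrite !mxE -fE.
Qed.

Definition zform n (M : 'M[zi]_n) (x y : 'rV[zi]_n) : zi :=
  (x *m M *m (map_mx zconj y)^T) 0 0.

Lemma map_mx_conjT m n (A : 'M[zi]_(m, n)) :
  (map_mx zi_algC A)^t* = map_mx zi_algC (map_mx zconj A)^T.
Proof. by apply/matrixP => i j; rewrite !mxE zi_algC_conj. Qed.

Lemma zi_algC_zform n (M : 'M[zi]_n) x y :
  zi_algC (zform M x y) = lattice_form (map_mx zi_algC M) (map_mx zi_algC x) (map_mx zi_algC y).
Proof. by rewrite /lattice_form map_mx_conjT -!map_mxM [RHS]mxE. Qed.

Lemma zform_rows m n (M : 'M[zi]_n) (X : 'M[zi]_(m, n)) i j :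
  (X *m M *m (map_mx zconj X)^T) i j = zform M (row i X) (row j X).
Proof.
rewrite /zform -row_mul !mxE; apply: eq_bigr => k _; rewrite !mxE.
by congr (_ * _); apply: eq_bigr => l _.
Qed.

Lemma map_zi_algC_inj m n :
  injective (fun A : 'M[zi]_(m, n) => map_mx zi_algC A).
Proof.
move=> A B /matrixP e; apply/matrixP => i j; have := e i j.
by rewrite !mxE => /zi_algC_inj.
Qed.

(** The rows of the coordinate matrix X are the images of the basis of the represented
    lattice. *)
Lemma representsP m n (M : 'M[zi]_n) (G : 'M[zi]_m) :
  represents (map_mx zi_algC M) (map_mx zi_algC G) <->
  exists X : 'M[zi]_(m, n), forall i j, zform M (row i X) (row j X) = G i j.
Proof.
split=> [[X /mxOver_gaussIntP[X0 ->]]|[X XE]].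
  rewrite map_mx_conjT -!map_mxM => /map_zi_algC_inj ->.
  by exists X0 => i j; rewrite zform_rows.
exists (map_mx zi_algC X); first by apply/mxOver_gaussIntP; exists X.
rewrite map_mx_conjT -!map_mxM; congr map_mx; apply/matrixP => i j.
by rewrite zform_rows XE.
Qed.

Lemma zform_hermitian n (M : 'M[zi]_n) :
  map_mx zi_algC M \is hermsymmx -> hermitian_form (zform M).
Proof.
rewrite is_hermitianmxE expr0 scale1r map_mx_conjT => /eqP/map_zi_algC_inj eM.
split=> [k x y z|x y]; first by rewrite /zform !mulmxDl -!scalemxAl !mxE.
have -> : zconj (zform M x y) = (map_mx zconj (x *m M *m (map_mx zconj y)^T))^T 0 0.
  by rewrite mxE mxE.
have conjKmx m p (A : 'M[zi]_(m, p)) : map_mx zconj (map_mx zconj A) = A.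
  by apply/matrixP => i j; rewrite !mxE zconjK.
congr (fun_of_matrix _ 0 0); rewrite !map_mxM !trmx_mul.
by rewrite -[in RHS]map_trmx trmxK conjKmx -eM mulmxA.
Qed.

Lemma zform_delta n (M : 'M[zi]_n) i j : zform M (delta_mx 0 i) (delta_mx 0 j) = M i j.
Proof. by rewrite /zform map_delta_mx trmx_delta -rowE -colE !mxE. Qed.

(** The Gram matrix (a b; b^* c). *)
Definition binary_mx (a : int) b (c : int) : 'M[zi]_2 :=
  \matrix_(i, j) if i == j then (if i == 0 then a else c)%:~R else if i == 0 then b else zconj b.

Lemma ord2 (i : 'I_2) : i = 0 \/ i = 1.
Proof. by case: i => [[|[|//]] ?]; [left|right]; apply: val_inj. Qed.

Lemma binary_mxP (G : 'M[zi]_2) : hermitian_form (zform G) ->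
  exists a b c, G = binary_mx a b c.
Proof.
move=> herm; have E := zform_delta G.
exists (zre (G 0 0)), (G 0 1), (zre (G 1 1)); apply/matrixP => i j.
rewrite !mxE -!E.
have [->|->] := ord2 i; have [->|->] := ord2 j => //=.
- exact: hform_real.
- exact: hformC.
- exact: hform_real.
Qed.

Lemma represents_binary n (M : 'M[zi]_n) a b c : hermitian_form (zform M) ->
  represents (map_mx zi_algC M) (map_mx zi_algC (binary_mx a b c)) <-> hrep (zform M) a b c.
Proof.
move=> herm; split=> [/representsP[X XE]|[x [y [xx xy yy]]]].
  by exists (row 0 X), (row 1 X); rewrite !XE !mxE.
apply/representsP; exists (\matrix_(i < 2) if i == 0 then x else y) => i j.
rewrite !rowK mxE.
by have [->|->] := ord2 i; have [->|->] := ord2 j; rewrite //= (hformC herm) xy.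
Qed.

Lemma positive_zform n (M : 'M[zi]_n) : positive_lattice (map_mx zi_algC M) ->
  hermitian_form (zform M) /\ forall x, x != 0 -> 0 < zre (zform M x x).
Proof.
move=> [[/zform_hermitian herm _] pos]; split=> // x x0.
have x_int : map_mx zi_algC x \is a mxOver gaussInt by apply/mxOver_gaussIntP; exists x.
have fx0 : map_mx zi_algC x != 0.
  by apply: contraNneq x0; rewrite -(map_mx0 zi_algC) => /map_zi_algC_inj->.
by have := pos _ x_int fx0; rewrite -zi_algC_zform {1}(hform_real herm x) rmorph_int ltr0z.
Qed.

(** The vector c v1 - b v2 has norm c D. *)
Lemma positive_binary a b c :
  positive_lattice (map_mx zi_algC (binary_mx a b c)) -> 0 < a /\ 0 < disc a b c.
Proof.
move=> /positive_zform[herm pos]; set h := zform _ in herm pos.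
have E i j : h (delta_mx 0 i) (delta_mx 0 j) = binary_mx a b c i j := zform_delta _ i j.
set d := fun i : 'I_2 => delta_mx 0 i : 'rV[zi]_2.
have d_neq0 i : d i != 0.
  by apply/eqP => /matrixP/(_ 0 i)/eqP; rewrite !mxE !eqxx.
have a0 : 0 < a by have := pos _ (d_neq0 0); rewrite E mxE /= zre_int.
have c0 : 0 < c by have := pos _ (d_neq0 1); rewrite E mxE /= zre_int.
split=> //; pose x := c%:~R *: d 0 + (- b) *: d 1.
have x0 : x != 0.
  apply/eqP => /matrixP/(_ 0 0); rewrite !mxE /= mulr1 mulr0 addr0 => /eqP.
  by rewrite -znorm_eq0 znorm_int; move: c0; nia.
have : h x x = (c * disc a b c)%:~R.
  rewrite !(hformE herm) !E !mxE /= /disc intrM rmorphB /= intrM znormE.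
  by rewrite rmorphN rmorph_int; ring.
by have := pos x x0 => + hx; rewrite hx zre_int pmulr_rgt0.
Qed.

Lemma two_universal_of_hrep n (M : 'M[zi]_n) : hermitian_form (zform M) ->
  (forall a b c, 0 < a -> 0 < disc a b c -> hrep (zform M) a b c) ->
  two_universal (map_mx zi_algC M).
Proof.
move=> herm univ Ml pos; have [[_ /mxOver_gaussIntP[G eG]] _] := pos.
rewrite eG in pos *; have [hermG _] := positive_zform pos.
have [a [b [c eabc]]] := binary_mxP hermG; rewrite eabc in pos *.
by have [a0 D0] := positive_binary pos; apply/represents_binary/univ.
Qed.

Lemma lattice_1_1E : lattice_1_1 = map_mx zi_algC (binary_mx 1 0 1).
Proof.
apply/matrixP => i j; rewrite !mxE.
have [->|->] := ord2 i; have [->|->] := ord2 j; rewrite /= ?mulr1n ?mulr0n ?rmorph0 ?rmorph1 //.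
Qed.

Lemma lattice_21_12E : lattice_21_12 = map_mx zi_algC (binary_mx 2 1 2).
Proof.
apply/matrixP => i j; rewrite !mxE.
have [->|->] := ord2 i; have [->|->] := ord2 j; rewrite /= ?rmorph_int ?rmorph1 //.
Qed.

Theorem theorem8 (n : nat) (ML : 'M[algC]_n) :
  positive_lattice ML ->
  represents ML lattice_1_1 ->
  represents ML lattice_21_12 ->
  two_universal ML.
Proof.
move=> pos; have [[_ /mxOver_gaussIntP[M eM]] _] := pos; rewrite {ML}eM in pos *.
have [herm hpos] := positive_zform pos; rewrite lattice_1_1E lattice_21_12E.
move=> /(represents_binary _ _ _ herm)[e1 [e2 [e11 e12 e22]]].
move=> /(represents_binary _ _ _ herm)[u [v [uu uv vv]]].
apply: two_universal_of_hrep => //; apply: two_universal_hform => //.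
  by exists e1, e2.
by exists u, v.
Qed.
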